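(* Let $n\ge1$, $s\ge1$, and let $X_1,\dots,X_s$ be scalar indeterminates. For integers $p_1,\dots,p_s\ge1$ set $$a_{n,p_1,\dots,p_s}(\alpha)=\sum_{\substack{\lambda^1,\dots,\lambda^s\vdash n\\ \ell(\lambda^i)=p_i}}\ \sum_{\beta\vdash n}\frac{1}{h_\beta(\alpha)h'_\beta(\alpha)}\prod_{i=1}^s\theta^\beta_{\lambda^i}(\alpha).$$ Then $$\sum_{p_1,\dots,p_s\ge1}a_{n,p_1,\dots,p_s}(\alpha)\prod_{i=1}^sX_i^{p_i}=\sum_{\beta\vdash n}\frac{1}{h_\beta(\alpha)h'_\beta(\alpha)}\prod_{i=1}^sR^\alpha_\beta(X_i),$$ where $R^\alpha_\beta(X)=\prod_{s\in\beta}(X+\alpha a'(s)-l'(s))$.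
   Context: Partitions: $\lambda\vdash n$ has $\ell(\lambda)$ parts; $m_i(\lambda)$ is the number of parts equal to $i$, $z_\lambda=\prod_i i^{m_i(\lambda)}m_i(\lambda)!$. For a box $s$ of the Young diagram of $\beta$ (the $i$-th row having $\beta_i$ boxes), $a(s),l(s),a'(s),l'(s)$ are the numbers of boxes strictly to the east, south, west and north of $s$, respectively. $h_\beta(\alpha)=\prod_{s\in\beta}(\alpha a(s)+l(s)+1)$, $h'_\beta(\alpha)=\prod_{s\in\beta}(\alpha(1+a(s))+l(s))$. The Jack symmetric functions $J^\alpha_\lambda$ are orthogonal for $\langle p_\lambda,p_\mu\rangle_\alpha=\alpha^{\ell(\lambda)}z_\lambda\delta_{\lambda\mu}$ ($p$ = power sums) and satisfy $J^\alpha_\lambda=h_\lambda(\alpha)m_\lambda+\sum_{\mu<\lambda}u^\alpha_{\lambda\mu}m_\mu$ ($m$ = monomial symmetric functions, $<$ = dominance order). Jack characters $\theta^\lambda_\mu(\alpha)$ are defined by $J^\alpha_\lambda=\sum_{\mu\vdash n}\theta^\lambda_\mu(\alpha)p_\mu$. *)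

(* Defs.v *)
From HB Require Import structures.
From mathcomp Require Import all_boot all_order all_algebra.
From mathcomp Require Import fraction.
From mathcomp Require Import mpoly.

Set Implicit Arguments.
Unset Strict Implicit.
Unset Printing Implicit Defensive.

Import Order.TTheory GRing.Theory Num.Theory.

Local Open Scope ring_scope.

(** * Integer partitions *)

Definition is_part (n : nat) (s : seq nat) : bool :=
  [&& sorted geq s, 0%N \notin s & sumn s == n].

(* The bounds "at most n parts, each at most n" hold for every partition of n
   (see [intpart_surj]); they only serve to obtain a finite type. *)
Record intpart (n : nat) := IntPart {
  ipval : {bseq n of 'I_n.+1};
  _ : is_part n (map val (ipval : seq _)) }.

HB.instance Definition _ n := [isSub for @ipval n].
HB.instance Definition _ n := [Finite of intpart n by <:].

Definition parts n (la : intpart n) : seq nat := map val (ipval la : seq _).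
Coercion parts : intpart >-> seq.

Lemma intpartP n (la : intpart n) : is_part n la.
Proof. by case: la. Qed.

Lemma parts_inj n : injective (@parts n).
Proof.
move=> la mu E; apply: val_inj; apply: val_inj.
exact: (inj_map val_inj E).
Qed.

Lemma intpart_surj n (s : seq nat) :
  is_part n s -> exists la : intpart n, la = s :> seq nat.
Proof.
move=> ps; have /and3P[_ s0 /eqP sn] := ps.
have size_le : (size s <= n)%N.
  rewrite -sn; elim: s s0 {ps sn} => //= x s IH.
  rewrite inE negb_or eq_sym -lt0n => /andP[x0 /IH le].
  by rewrite -add1n leq_add.
have part_le x : x \in s -> (x < n.+1)%N.
  rewrite ltnS -sn; elim: s {ps s0 sn size_le} => //= y s IH.
  rewrite inE => /orP[/eqP ->|/IH le]; first exact: leq_addr.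
  exact: leq_trans le (leq_addl _ _).
pose t : seq 'I_n.+1 := map inord s.
have tE : map val t = s.
  rewrite -map_comp map_id_in // => x /part_le ltx.
  by rewrite /= inordK.
have size_t : (size t <= n)%N by rewrite size_map.
have pt : is_part n (map val (Bseq size_t : seq _)) by rewrite tE.
by exists (IntPart pt).
Qed.

Definition mult (i : nat) (la : seq nat) : nat := count_mem i la.

Definition zpart (la : seq nat) : nat :=
  \prod_(1 <= i < (sumn la).+1) (i ^ mult i la * (mult i la)`!)%N.

Definition dominated n (mu la : intpart n) : bool :=
  [forall k : 'I_n.+1, (sumn (take k mu) <= sumn (take k la))%N].

Definition sdominated n (mu la : intpart n) : bool :=
  (mu != la) && dominated mu la.

(** * Boxes *)

(* Rows and columns are numbered from 0; the box (i, j) of [la] is in row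
   i < size la and column j < nth 0 la i. *)
Definition arm (la : seq nat) (i j : nat) : nat := (nth 0%N la i - j.+1)%N.
Definition leg (la : seq nat) (i j : nat) : nat :=
  count (fun x => j < x)%N (drop i.+1 la).
Definition coarm (la : seq nat) (i j : nat) : nat := j.
Definition coleg (la : seq nat) (i j : nat) : nat := i.

Definition boxprod (A : comPzRingType) (la : seq nat) (f : nat -> nat -> A) : A :=
  \prod_(i < size la) \prod_(j < nth 0%N la i) f i j.

Definition hook (F : fieldType) (alpha : F) (la : seq nat) : F :=
  boxprod la (fun i j => alpha * (arm la i j)%:R + (leg la i j)%:R + 1).

Definition hook' (F : fieldType) (alpha : F) (la : seq nat) : F :=
  boxprod la (fun i j => alpha * (1 + (arm la i j)%:R) + (leg la i j)%:R).

(* R^alpha_la(X), evaluated at an element X of a commutative F-algebra. *)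
Definition jackR (F : fieldType) (A : comAlgType F) (alpha : F) (la : seq nat)
    (X : A) : A :=
  boxprod la
    (fun i j => X + (alpha * (coarm la i j)%:R - (coleg la i j)%:R)%:A).

(** * Symmetric functions *)

(* A symmetric function is given by its restrictions to x_1, ..., x_N, for all
   N.  Symmetry and compatibility of the restrictions are not part of the type:
   they hold for linear combinations of the [psym] or of the [msym]. *)
Definition symfun (F : fieldType) := forall N : nat, {mpoly F[N]}.

Definition psym (F : fieldType) (la : seq nat) : symfun F :=
  fun N => \prod_(k <- la) \sum_(i < N) 'X_i ^+ k.

(* The sum of all distinct monomials whose nonzero exponents are the parts of
   [la] in some order; such monomials have degree [sumn la]. *)
Definition msym (F : fieldType) (la : seq nat) : symfun F :=
  fun N => \sum_(m : 'X_{1..N < (sumn la).+1} |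
                 perm_eq [seq k <- [seq bmnm m i | i <- enum 'I_N] | 0 < k]%N la)
             'X_[bmnm m].

(* f = \sum_(mu |- n) c mu p_mu *)
Definition p_expansion (F : fieldType) n (f : symfun F) (c : intpart n -> F) :=
  forall N, f N = \sum_(mu : intpart n) c mu *: psym F mu N.

(* The scalar product <p_la, p_mu>_alpha = alpha ^ l(la) z_la delta_{la mu} of
   \sum_mu c mu p_mu and \sum_mu d mu p_mu. *)
Definition jack_dot (F : fieldType) (alpha : F) n (c d : intpart n -> F) : F :=
  \sum_(mu : intpart n) c mu * d mu * (alpha ^+ size mu * (zpart mu)%:R).

(* The power sums being a basis in characteristic 0, f and g have exactly one
   expansion each. *)
Definition jack_orthogonal (F : fieldType) (alpha : F) n (f g : symfun F) :=
  forall c d : intpart n -> F,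
    p_expansion f c -> p_expansion g d -> jack_dot alpha c d = 0.

(** * Jack symmetric functions and Jack characters *)

(* alpha is not a nonpositive rational number.  This covers an indeterminate
   and a positive real ([jack_param_indeterminate], [jack_param_pos]). *)
Definition jack_param (F : fieldType) (alpha : F) :=
  forall a b : nat, (0 < a)%N -> a%:R * alpha + b%:R != 0.

Lemma jack_param_indeterminate (K : fieldType) :
  [pchar K] =i pred0 -> jack_param (tofrac ('X : {poly K})).
Proof.
move=> K0 a b a0.
have -> : a%:R * tofrac 'X + b%:R = tofrac (a%:R *: 'X + b%:R%:P : {poly K}).
  by rewrite rmorphD /= -mul_polyC rmorphM /= !polyC_natr !rmorph_nat.
rewrite tofrac_eq0; apply/eqP => /(congr1 (fun p : {poly K} => p`_1)) /eqP.
rewrite coefD coefZ coefX coefC /= coef0 mulr1 addr0.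
by rewrite ((pcharf0P K).1 K0) => /eqP a_eq0; rewrite a_eq0 in a0.
Qed.

Lemma jack_param_pos (R : realFieldType) (alpha : R) :
  0 < alpha -> jack_param alpha.
Proof.
move=> alpha0 a b a0; rewrite gt_eqF // ltr_wpDr ?ler0n //.
by rewrite mulr_gt0 // ltr0n.
Qed.

Record jack_functions (F : fieldType) (alpha : F)
    (J : forall n, intpart n -> symfun F) : Prop := JackFunctions {
  jack_orth : forall n (la mu : intpart n), la != mu ->
    jack_orthogonal alpha n (J n la) (J n mu);
  jack_triangular : forall n (la : intpart n),
    exists u : intpart n -> F, forall N,
      J n la N = hook alpha la *: msym F la N
                 + \sum_(mu : intpart n | sdominated mu la) u mu *: msym F mu N }.

(* [theta n la mu] is the Jack character theta^la_mu. *)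
Definition jack_characters (F : fieldType)
    (J : forall n, intpart n -> symfun F)
    (theta : forall n, intpart n -> intpart n -> F) :=
  forall n (la : intpart n), p_expansion (J n la) (theta n la).

Definition jack_coef (F : fieldType) (alpha : F)
    (theta : forall n, intpart n -> intpart n -> F)
    (n s : nat) (p : 'I_s -> nat) : F :=
  \sum_(la : {ffun 'I_s -> intpart n} | [forall i, size (la i) == p i])
    \sum_(beta : intpart n)
      (hook alpha beta * hook' alpha beta)^-1 * \prod_(i < s) theta n beta (la i).

(* Main.v *)
(** Summing over p and la turns the left-hand side into
    \sum_beta (h_beta h'_beta)^-1 \prod_i \sum_mu theta^beta_mu X_i^l(mu), so the
    point is the principal specialization
      \sum_mu theta^beta_mu X^l(mu) = R_beta(X).
    It is enough to prove it for X a large integer N, where the left-hand side is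
    J_beta(1, ..., 1) in N variables.

    The Cherednik operators xi_0, ..., xi_(N-1) have joint eigenfunctions E_m, one
    for each composition m: they are built from 1 by the intertwiners
    s_i + (c_(i+1) - c_i)^-1, where c is the spectrum of the function they are
    applied to, and by f |-> x_(N-1) f(x_(N-1), x_0, ..., x_(N-2)), which
    multiply the value at (1, ..., 1) by 1 + (c_(i+1) - c_i)^-1 and by 1. Adding
    the first column to a partition by such steps gives E_m(1, ..., 1) for m
    increasing, and symmetrizing E_m gives a monic, dominance-triangular
    eigenfunction of \sum_i xi_i^2. On power sums this operator is, up to a
    constant, a Laplace-Beltrami operator, which is self-adjoint for the scalar
    product of the Jack functions, so these eigenfunctions are the J_beta up to
    the factor h_beta. *)
From HB Require Import structures.
Require Import Defs.
From mathcomp Require Import all_boot all_order all_algebra all_fingroup.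
From mathcomp Require Import mpoly ring zify.

Set Implicit Arguments.
Unset Strict Implicit.
Unset Printing Implicit Defensive.

Import Order.TTheory GRing.Theory Num.Theory.

Local Open Scope ring_scope.

(** * Cherednik operators *)

Section DividedDifferences.
Variables (F : fieldType) (N : nat).
Implicit Types (f g : {mpoly F[N]}) (i j k : 'I_N) (s : 'S_N).

Local Notation sw i j := (msym (tperm i j)).

(** Nonsymmetric polynomials make the value at (1, ..., 1) computable: each elementary step
    multiplies it by an explicit scalar, and the scalars of a whole column telescope into hook and
    content factors. Denominators and eigenvalue gaps are, up to sign, products of terms a al + b
    with a, b >= 0 not both zero; [jack_param] and characteristic 0 keep them nonzero. The Jack
    functions are characterized in two different pictures: triangularity on monomials in N
    variables, orthogonality on coefficients of power sums. The operator \sum_i xi_i^2 is computed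
    in both. For N >= n they determine each other in degree n, because the power sums are then
    independent, a fact read off from the Jack functions themselves. The eigenvalues may coincide
    for incomparable partitions, such as (4, 1, 1) and (3, 3). Only partitions comparable for
    dominance need to be separated, since the identification goes by induction along that order. *)

Lemma mpolyX_eq0 (m : 'X_{1..N}) : ('X_[m] == 0 :> {mpoly F[N]}) = false.
Proof.
by apply/eqP => /(congr1 (mcoeff m)) /eqP; rewrite mcoeffX eqxx mcoeff0 oner_eq0.
Qed.

Lemma mpolyXB_neq0 i j : i != j -> ('X_i - 'X_j : {mpoly F[N]}) != 0.
Proof.
move=> ij; apply/eqP => /(congr1 (mcoeff U_(i)%MM)) /eqP.
by rewrite mcoeffB !mcoeffXU eqxx mcoeff0 [j == i]eq_sym (negPf ij) subr0 oner_eq0.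
Qed.

Lemma msymXU s i : msym s 'X_i = 'X_(s i) :> {mpoly F[N]}.
Proof.
rewrite msymX; congr 'X_[_]; apply/mnmP => j; rewrite !mnmE.
by rewrite (canF_eq (permK s)).
Qed.

Lemma msym_sum (I : Type) (r : seq I) (P : pred I) (G : I -> {mpoly F[N]}) s :
  msym s (\sum_(i <- r | P i) G i) = \sum_(i <- r | P i) msym s (G i).
Proof. exact: raddf_sum. Qed.

Lemma msym_swK i j f : sw i j (sw i j f) = f.
Proof. by rewrite -msymMm tperm2 msym1m. Qed.

Lemma msym_sw s i j f : msym s (sw i j f) = sw (s i) (s j) (msym s f).
Proof.
rewrite -!msymMm; congr (msym _ f); rewrite -tpermJ /conjg.
by rewrite mulgA mulgA mulgV mul1g.
Qed.

(** The twisted Leibniz rule X_k u - s(X_k u) = X_k (u - s u) + (X_k - X_{s k}) s u, with s the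
    transposition, reduces a monomial to one of smaller degree. *)
Lemma divdiff_ex i j f : exists g, ('X_i - 'X_j) * g == f - sw i j f.
Proof.
elim/mpolyind: f => [|c m f _ _ [g /eqP IH]].
  by exists 0; rewrite mulr0 msym0 subr0.
suff [h /eqP E] : exists h : {mpoly F[N]}, ('X_i - 'X_j) * h == 'X_[m] - sw i j 'X_[m].
  exists (c *: h + g); rewrite mulrDr -scalerAr E IH msymD msymZ.
  by apply/eqP; rewrite scalerBr opprD addrACA.
have [d dm] := ubnP (mdeg m); elim: d => // d IHd in m dm *.
have [|mN0] := boolP (mdeg m == 0%N).
  rewrite mdeg_eq0 => /eqP ->.
  by exists 0; rewrite mulr0 mpolyX0 msym1 subrr.
have /existsP[k mk] : [exists k, m k != 0%N].
  rewrite -negb_forall; apply: contra mN0 => /forallP m0.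
  by rewrite mdegE big1 // => k _; apply/eqP.
have [m' mE] : exists m', m = (U_(k) + m')%MM.
  by exists (m - U_(k))%MM; rewrite addmC submK // lep1mP.
have {IHd} [|h /eqP Eh] := IHd m'.
  by move: dm; rewrite mE mdegD mdeg1.
have [l /eqP El] : exists l : {mpoly F[N]}, ('X_i - 'X_j) * l == ('X_k - 'X_(tperm i j k) : {mpoly F[N]}).
  by case: tpermP => [->|->|_ _]; [exists 1|exists (-1)|exists 0];
    rewrite ?mulr1 ?mulrN1 ?mulr0 ?opprB ?subrr.
exists ('X_k * h + l * sw i j 'X_[m']).
rewrite mE mpolyXD msymM msymXU mulrDr mulrCA Eh mulrA El.
by apply/eqP; ring.
Qed.

(** Any witness will do: for i != j the quotient is unique ([divdiffE]). The value 0 at i = j lets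
    sums over all j run without a side condition. *)
Definition divdiff i j f : {mpoly F[N]} :=
  locked (if i == j then 0 else xchoose (divdiff_ex i j f)).

Lemma divdiffii i f : divdiff i i f = 0.
Proof. by rewrite /divdiff -lock eqxx. Qed.

Lemma divdiffP i j f : ('X_i - 'X_j) * divdiff i j f = f - sw i j f.
Proof.
rewrite /divdiff -lock; case: eqVneq => [->|_]; last exact/eqP/(xchooseP (divdiff_ex i j f)).
by rewrite mulr0 tperm1 msym1m subrr.
Qed.

Lemma divdiffE i j f g : i != j -> ('X_i - 'X_j) * g = f - sw i j f -> divdiff i j f = g.
Proof.
by move=> ij E; apply: (mulfI (mpolyXB_neq0 ij)); rewrite divdiffP E.
Qed.

Lemma divdiff_lin i j (c : F) f g : divdiff i j (c *: f + g) = c *: divdiff i j f + divdiff i j g.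
Proof.
have [->|ij] := eqVneq i j; first by rewrite !divdiffii scaler0 addr0.
have E1 := divdiffP i j f; have E2 := divdiffP i j g; apply: divdiffE => //.
transitivity (c *: (f - sw i j f) + (g - sw i j g)).
  by rewrite -E1 -E2 mulrDr -scalerAr.
by rewrite msymD msymZ scalerBr opprD addrACA.
Qed.

Lemma divdiffC i j f : divdiff i j f = - divdiff j i f.
Proof.
have [->|ij] := eqVneq i j; first by rewrite !divdiffii oppr0.
by apply: divdiffE => //; rewrite mulrN -mulNr opprB divdiffP tpermC.
Qed.

Lemma divdiff_msym s i j f : msym s (divdiff i j f) = divdiff (s i) (s j) (msym s f).
Proof.
have [->|ij] := eqVneq i j; first by rewrite !divdiffii msym0.
apply/esym/divdiffE; first by rewrite (inj_eq perm_inj).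
by rewrite -msym_sw -!msymXU -!msymB -msymM divdiffP.
Qed.

Lemma divdiff_mul_sym i j (h f : {mpoly F[N]}) : sw i j h = h -> divdiff i j (h * f) = h * divdiff i j f.
Proof.
move=> hs; have [->|ij] := eqVneq i j; first by rewrite !divdiffii mulr0.
apply: divdiffE => //; rewrite mulrCA divdiffP msymM hs.
exact: mulrBr.
Qed.

Lemma mderiv_msym s i f : msym s f^`M(i) = (msym s f)^`M(s i).
Proof.
apply/mpolyP => m; rewrite mcoeff_sym !mcoeff_deriv mcoeff_sym mnmE.
congr (_@__ *+ _); apply/mnmP => j; rewrite !mnmE.
by rewrite (inj_eq perm_inj).
Qed.

Variable al : F.

(* The constant -i of the usual Cherednik operator is distributed over the j < i,
   which makes [tau_msym] a statement about a single pair of indices. *)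
Definition tau i j f : {mpoly F[N]} :=
  'X_(if (j < i)%N then i else j) * divdiff i j f - (j < i)%N%:R * f.

Definition cherednik i f : {mpoly F[N]} :=
  locked (al *: ('X_i * f^`M(i)) + \sum_j tau i j f).

Local Notation xi := cherednik.

Lemma cherednikE i f : xi i f = al *: ('X_i * f^`M(i)) + \sum_j tau i j f.
Proof. by rewrite /cherednik -lock. Qed.

Lemma tauii i f : tau i i f = 0.
Proof. by rewrite /tau ltnn divdiffii mulr0 mul0r subr0. Qed.

Lemma tau_lin i j (c : F) f g : tau i j (c *: f + g) = c *: tau i j f + tau i j g.
Proof.
rewrite /tau divdiff_lin !mulrDr -!scalerAr !opprD addrACA; congr (_ + _).
by rewrite scalerBr.
Qed.

Lemma cherednik_lin i (c : F) f g : xi i (c *: f + g) = c *: xi i f + xi i g.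
Proof.
rewrite !cherednikE mderivD mderivZ (eq_bigr _ (fun j _ => tau_lin i j c f g)).
rewrite big_split /= -scaler_sumr mulrDr -scalerAr !scalerDr -!addrA.
rewrite !scalerA [al * c]mulrC; congr (_ + _).
by rewrite addrCA.
Qed.

HB.instance Definition _ i := GRing.isLinear.Build F _ _ _ (xi i)
  (fun c f g => cherednik_lin i c f g).

Lemma cherednikZ i c f : xi i (c *: f) = c *: xi i f. Proof. exact: linearZ. Qed.
Lemma cherednikD i f g : xi i (f + g) = xi i f + xi i g. Proof. exact: raddfD. Qed.

(** With D the divided difference, [tau i j f] equals X_j D f, minus s_{ij} f when j < i. Only this
    second term sees the order of i and j, so a permutation reversing that order produces one
    transposed term. *)
Lemma tau_msym s i j f : i != j ->
  msym s (tau i j f) = tau (s i) (s j) (msym s f)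
    + ((i < j)%N && (s j < s i)%N)%:R * msym s (sw i j f)
    - ((j < i)%N && (s i < s j)%N)%:R * msym s (sw i j f).
Proof.
move=> ij; have sij : s i != s j by rewrite (inj_eq perm_inj).
rewrite /tau msymB !msymM divdiff_msym msym_sw.
have -> : forall b : bool, msym s (b%:R : {mpoly F[N]}) = b%:R.
  by case; rewrite ?msym1 ?msym0.
have := divdiffP (s i) (s j) (msym s f).
move: ij sij; rewrite -!(inj_eq val_inj) /= => ij sij.
set D := divdiff _ _ _; set f' := msym s f; set f'' := sw _ _ _ => E.
have -> : f'' = f' - ('X_(s i) - 'X_(s j)) * D by rewrite E subKr.
case: (ltngtP i j) ij => // lij _; case: (ltngtP (s i) (s j)) sij => // lsij _ /=;
  rewrite msymXU; ring.
Qed.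

Lemma cherednik_msym s i f :
  msym s (xi i f) = xi (s i) (msym s f)
    + \sum_(j : 'I_N | (i < j)%N && (s j < s i)%N) msym s (sw i j f)
    - \sum_(j : 'I_N | (j < i)%N && (s i < s j)%N) msym s (sw i j f).
Proof.
rewrite !cherednikE msymD msymZ msymM msymXU mderiv_msym msym_sum -!addrA; congr (_ + _).
rewrite [\sum_j tau (s i) _ _](reindex_inj (@perm_inj _ s)) /=.
rewrite [X in _ = _ + (X - _)]big_mkcond [X in _ = _ + (_ - X)]big_mkcond -sumrN -!big_split /=.
apply: eq_bigr => j _.
have [<-|ij] := eqVneq i j; first by rewrite !tauii msym0 ltnn /= subr0 addr0.
rewrite tau_msym //.
by case: ifP => _; case: ifP => _; rewrite ?mul1r ?mul0r ?subr0 ?addr0 ?addrA ?sub0r ?oppr0 ?addr0.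
Qed.

End DividedDifferences.

(** * Triangularity *)

Section Triangularity.
Variables (F : fieldType) (N : nat).
Implicit Types (f g : {mpoly F[N]}) (i j p q : 'I_N) (m k : 'X_{1..N}).

Definition transfer p q m t : 'X_{1..N} := (m - U_(p) *+ t + U_(q) *+ t)%MM.

Lemma transferE p q m t i : p != q ->
  transfer p q m t i =
    if i == p then (m p - t)%N else if i == q then (m q + t)%N else m i.
Proof.
move=> pq; rewrite !(mnmDE, mnmBE, mulmnE, mnm1E).
rewrite [p == i]eq_sym [q == i]eq_sym.
have [->|ip] := eqVneq i p; first by rewrite (negPf pq) mul1n mul0n addn0.
by have [->|iq] := eqVneq i q; rewrite ?mul0n ?mul1n subn0 ?addn0.
Qed.

Lemma transfer0 p q m : transfer p q m 0 = m.
Proof. by apply/mnmP => i; rewrite !(mnmDE, mnmBE, mulmnE) !muln0 subn0 addn0. Qed.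

Lemma transferS p q m t : p != q -> (t < m p)%N ->
  'X_q * 'X_[transfer p q m t] = 'X_p * 'X_[transfer p q m t.+1] :> {mpoly F[N]}.
Proof.
move=> pq tm; rewrite -!mpolyXD; congr 'X_[_]; apply/mnmP => i.
rewrite mnmDE transferE // mnmDE transferE // !mnm1E [p == i]eq_sym [q == i]eq_sym.
have [->|ip] := eqVneq i p; first by rewrite (negPf pq) /=; lia.
by have [iq|iq] := eqVneq i q; rewrite /= ?iq; lia.
Qed.

(** Multiplied by X_p - X_q the sum telescopes, by [transferS]; the end term t = m p - m q is m with
    its exponents at p and q exchanged. *)
Lemma mul_X_divdiff p q m : p != q -> (m q <= m p)%N ->
  'X_p * divdiff p q 'X_[m] = \sum_(t < m p - m q) 'X_[transfer p q m t] :> {mpoly F[N]}.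
Proof.
move=> pq mqp; apply: (mulfI (mpolyXB_neq0 F pq)); rewrite mulrCA divdiffP.
rewrite mulr_sumr (eq_bigr (fun t : 'I_(m p - m q) =>
    - ('X_p * 'X_[transfer p q m t.+1] - 'X_p * 'X_[transfer p q m t]))); last first.
  move=> t _; rewrite mulrBl transferS ?opprB //.
  by apply: leq_trans (ltn_ord t) _; rewrite leq_subr.
rewrite sumrN -(big_mkord xpredT (fun t => 'X_p * 'X_[transfer p q m t.+1] -
    'X_p * 'X_[transfer p q m t])) telescope_sumr // opprB -mulrBr transfer0.
congr (_ * (_ - _)); rewrite msymX; congr 'X_[_]; apply/mnmP => i.
rewrite transferE // mnmE tpermV.
by case: tpermP => [->|->|/eqP/negPf -> /eqP/negPf ->] //;
  rewrite ?eqxx ?[q == p]eq_sym ?(negPf pq); lia.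
Qed.

Lemma mul_X_divdiff' p q m : p != q -> (m q <= m p)%N ->
  'X_q * divdiff p q 'X_[m] = \sum_(t < m p - m q) 'X_[transfer p q m t.+1] :> {mpoly F[N]}.
Proof.
move=> pq mqp; have Xp0 : ('X_p : {mpoly F[N]}) != 0 by rewrite mpolyX_eq0.
apply: (mulfI Xp0); rewrite mulrCA mul_X_divdiff // !mulr_sumr; apply: eq_bigr => t _.
by rewrite transferS //; apply: leq_trans (ltn_ord t) _; rewrite leq_subr.
Qed.

(** Moving t units from p to q, where m p = m q + t + d, lowers the quadratic part by 2 N t d and
    adds t (p - q), less than N t, to the linear part. The squares thus decide unless d = 0, when
    the move exchanges the two exponents and the positions decide. *)
Definition weightQ m : nat := (\sum_i (N * m i ^ 2 + (N - i) * m i))%N.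
Definition excess c m : nat := (\sum_i (m i - c))%N.

(* weightQ decreases along the triangular expansion of the Cherednik operators;
   excess c, for all c together, controls the dominance order. *)
Definition lower c m k : bool :=
  [&& (weightQ m < weightQ k)%N, (excess c m <= excess c k)%N & mdeg m == mdeg k].

Lemma lower_trans c : transitive (lower c).
Proof.
move=> k m l /and3P[Q1 K1 /eqP d1] /and3P[Q2 K2 /eqP d2]; apply/and3P; split.
- exact: ltn_trans Q1 Q2.
- exact: leq_trans K1 K2.
- by rewrite d1 d2.
Qed.

Lemma sum_two p q (G : 'I_N -> nat) : p != q ->
  (\sum_i G i = G p + (G q + \sum_(i | (i != p) && (i != q)) G i))%N.
Proof.
by move=> pq; rewrite (bigD1 p) //= (bigD1 q) //= eq_sym.
Qed.

Lemma lower_transfer c p q m t : p != q -> (0 < t <= m p - m q)%N ->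
  (t < m p - m q)%N || (p < q)%N -> lower c (transfer p q m t) m.
Proof.
move=> pq /andP[t0 td] tpq; have := ltn_ord p; have := ltn_ord q.
have qp : q != p by rewrite eq_sym.
have E (G : 'I_N -> nat -> nat) : (\sum_i G i (transfer p q m t i) =
    G p (m p - t) + (G q (m q + t) + \sum_(i | (i != p) && (i != q)) G i (m i)))%N.
  rewrite (sum_two _ pq) !transferE // eqxx (negPf qp) eqxx; congr (_ + (_ + _))%N.
  by apply: eq_bigr => i /andP[/negPf ip /negPf iq]; rewrite transferE // ip iq.
move=> qN pN; apply/and3P; split.
- rewrite /weightQ (E (fun i x => N * x ^ 2 + (N - i) * x)%N) (sum_two _ pq) !addnA ltn_add2r.
  have [d de] : exists d, m p = (m q + (t + d))%N.
    by exists (m p - m q - t)%N; lia.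
  have dpq : (0 < d)%N || (p < q)%N by move: tpq; rewrite de; lia.
  rewrite de; have -> : (m q + (t + d) - t = m q + d)%N by lia.
  have [p' pE] : exists p' : nat, (N = p + p')%N by exists (N - p)%N; lia.
  have [q' qE] : exists q' : nat, (N = q + q')%N by exists (N - q)%N; lia.
  have -> : (N - p = p')%N by lia.
  have -> : (N - q = q')%N by lia.
  have : (t * q' < 2 * N * t * d + t * p')%N.
    case: (posnP d) dpq => [-> /= lpq|d0 _].
      by rewrite muln0 add0n ltn_mul2l t0 /=; lia.
    have q'N : (q' <= N)%N by lia.
    have N0 : (0 < N)%N by apply: leq_ltn_trans qN.
    have : (t * q' <= t * N * d)%N by rewrite -mulnA leq_mul2l -[q']muln1 leq_mul ?orbT.
    have : (0 < t * N * d)%N by rewrite !muln_gt0 t0 N0.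
    rewrite -!mulnA [(N * (t * d))%N]mulnCA; lia.
  rewrite -!mulnn; move: (m q) p' q' {pE qE de} => b p' q' H; nia.
- rewrite /excess (E (fun i x => x - c)%N) (sum_two _ pq) !addnA leq_add2r; lia.
- rewrite !mdegE (E (fun i x => x)) (sum_two _ pq) !addnA; lia.
Qed.

Definition before m j i : bool := (m i < m j)%N || (m i == m j) && (j < i)%N.

Lemma mcoeff_sum_transfer c p q m d k : p != q -> (d <= m p - m q)%N ->
  (d < m p - m q)%N || (p < q)%N -> ~~ lower c k m ->
  \sum_(t < d) 'X_[transfer p q m t.+1]@_k = 0 :> F.
Proof.
move=> pq dm dpq kN; apply: big1 => t _; rewrite mcoeffX.
case: eqP => // tE; case/negP: kN; rewrite -tE; apply: lower_transfer => //=.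
  by have := ltn_ord t; lia.
by have := ltn_ord t; lia.
Qed.

(** Apart from m itself, the monomials of [tau i j 'X_[m]] are transfers, hence lower than m. Copies
    of m come from t = 0 in the geometric sum and from -f; they add up to -1 when j is before i and
    to 0 otherwise. *)
Lemma mcoeff_tau c i j m k : ~~ lower c k m ->
  (tau i j 'X_[m])@_k = - (before m j i)%:R * (m == k)%:R :> F.
Proof.
move=> kN; have [->|ij] := eqVneq i j.
  by rewrite tauii mcoeff0 /before !ltnn andbF oppr0 mul0r.
have ji : j != i by rewrite eq_sym.
have natM (b : bool) : (b%:R * 'X_[m] : {mpoly F[N]})@_k = b%:R * (m == k)%:R.
  by case: b; rewrite ?mul1r ?mcoeffX // !mul0r mcoeff0.
rewrite /tau mcoeffB natM.
case: (ltngtP j i) => [lji|lij|/val_inj E]; last by rewrite E eqxx in ij.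
- rewrite mul1r; have [mji|mij] := leqP (m j) (m i).
  + rewrite mul_X_divdiff // raddf_sum /=.
    case E: (m i - m j)%N => [|d].
      have -> : before m j i = true by rewrite /before; lia.
      by rewrite big_ord0 sub0r mulN1r.
    have -> : before m j i = false by rewrite /before; lia.
    rewrite big_ord_recl transfer0 (mcoeff_sum_transfer (c := c)) //; last 2 first.
    + by rewrite E.
    + by rewrite E ltnSn.
    by rewrite mcoeffX addr0 subrr oppr0 mul0r.
  + have -> : before m j i = true by rewrite /before; lia.
    rewrite divdiffC mulrN mul_X_divdiff' //; last exact: ltnW.
    rewrite mcoeffN raddf_sum /= (mcoeff_sum_transfer (c := c)) // ?lji ?orbT //.
    by rewrite oppr0 sub0r mulN1r.
- rewrite mul0r subr0; have [mji|mij] := leqP (m j) (m i).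
  + have -> : before m j i = false by rewrite /before; lia.
    rewrite mul_X_divdiff' // raddf_sum /= (mcoeff_sum_transfer (c := c)) // ?lij ?orbT //.
    by rewrite oppr0 mul0r.
  + have -> : before m j i = true by rewrite /before; lia.
    rewrite divdiffC mulrN mul_X_divdiff //; last exact: ltnW.
    rewrite mcoeffN raddf_sum /=.
    case E: (m j - m i)%N => [|d]; first by lia.
    rewrite big_ord_recl transfer0 (mcoeff_sum_transfer (c := c)) //; last 2 first.
    + by rewrite E.
    + by rewrite E ltnSn.
    by rewrite mcoeffX addr0 mulN1r.
Qed.

Variable al : F.
Local Notation xi := (cherednik al).

(** The position of i once the exponents are put in decreasing order, ties keeping the order of
    indices. So [spectrum m] lists the numbers al la_r - r, where la is the decreasing rearrangement
    of m. *)
Definition rank m i : nat := (\sum_j before m j i)%N.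
Definition spectrum m i : F := al * (m i)%:R - (rank m i)%:R.

Lemma mcoeff_cherednik c i m k : ~~ lower c k m ->
  (xi i 'X_[m])@_k = spectrum m i * (m == k)%:R.
Proof.
move=> kN; rewrite cherednikE mcoeffD mcoeffZ raddf_sum /=.
rewrite (eq_bigr _ (fun j _ => mcoeff_tau i j kN)) -mulr_suml mulrBl /spectrum.
rewrite sumrN natr_sum mulNr; congr (_ - _).
rewrite mderivX -scalerAr mcoeffZ -mpolyXD mcoeffX -mulrA; congr (_ * _).
have [->|mi0] := eqVneq (m i) 0%N; first by rewrite !mul0r.
by rewrite addmC submK // lep1mP.
Qed.

Lemma mcoeff_cherednik_max c i f k : (forall m, m \in msupp f -> ~~ lower c k m) ->
  (xi i f)@_k = spectrum k i * f@_k.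
Proof.
move=> kmax; rewrite [in LHS](mpolyE f) raddf_sum /= raddf_sum /=.
rewrite big_seq (eq_bigr (fun m => spectrum k i * (f@_m * (m == k)%:R))); last first.
  move=> m /kmax km; rewrite cherednikZ mcoeffZ (mcoeff_cherednik _ km) mulrCA.
  by case: eqP => [->|] //; rewrite !mulr0.
rewrite -big_seq -mulr_sumr; congr (_ * _).
rewrite [in RHS](mpolyE f) raddf_sum /=; apply: eq_bigr => m _.
by rewrite mcoeffZ mcoeffX.
Qed.

Lemma before_trans m : transitive (before m).
Proof. by move=> j i l; rewrite /before; lia. Qed.

Lemma before_irr m i : before m i i = false.
Proof. by rewrite /before !ltnn andbF. Qed.

Lemma before_total m i j : i != j -> before m i j = ~~ before m j i.
Proof. rewrite /before -(inj_eq val_inj) /=; lia. Qed.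

Lemma rank_before m i j : before m j i -> (rank m j < rank m i)%N.
Proof.
move=> ji; rewrite /rank [X in (_ < X)%N](bigD1 j) //= ji add1n ltnS.
rewrite (bigD1 j) //= before_irr add0n; apply: leq_sum => l _.
by case lj: (before m l j) => //; rewrite (before_trans lj ji).
Qed.

Hypothesis charF0 : [pchar F] =i pred0.
Hypothesis alP : jack_param al.

Lemma param_neq0 a b : (0 < a + b)%N -> a%:R * al + b%:R != 0.
Proof.
case: a => [|a] ab; last exact: alP.
by rewrite mul0r add0r ((pcharf0P F).1 charF0) -lt0n.
Qed.

Lemma spectrum_before m i j : before m j i ->
  exists a b, (0 < b)%N /\ spectrum m j - spectrum m i = a%:R * al + b%:R.
Proof.
move=> ji; exists (m j - m i)%N, (rank m i - rank m j)%N.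
have rji := rank_before ji; split; first by rewrite subn_gt0.
have mij : (m i <= m j)%N by move: ji; rewrite /before; lia.
rewrite !natrB ?(ltnW rji) //.
by rewrite /spectrum; ring.
Qed.

Lemma spectrum_neq m i j : i != j -> spectrum m i != spectrum m j.
Proof.
move=> ij; wlog ji : i j ij / before m j i => [H|].
  case E: (before m j i); first exact: H.
  by rewrite eq_sym; apply: H; rewrite 1?eq_sym // before_total // E.
have [a [b [b0 E]]] := spectrum_before ji.
by rewrite eq_sym -subr_eq0 E param_neq0 // addn_gt0 b0 orbT.
Qed.

(** If m and k ordered two positions oppositely, the differences given by [spectrum_before] would be
    opposite and their sum (a + a') al + (b + b') would vanish. So the orders agree, hence the
    ranks, and then the exponents because al != 0 and the characteristic is 0. *)
Lemma spectrum_inj m k : spectrum m =1 spectrum k -> m = k.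
Proof.
move=> E.
have B i j : before m i j -> before k i j.
  move=> mij; have ij : i != j by apply: contraTneq mij => ->; rewrite before_irr.
  rewrite before_total //; apply/negP => kji.
  have [a [b [b0 E1]]] := spectrum_before mij.
  have [a' [b' [b0' E2]]] := spectrum_before kji.
  have /negP[] := @param_neq0 (a + a') (b + b') ltac:(lia).
  by rewrite !natrD mulrDl addrACA -E1 -E2 !E; apply/eqP; ring.
have R i : rank m i = rank k i.
  apply: eq_bigr => j _; congr nat_of_bool; apply/idP/idP; first exact: B.
  move=> kji; have ij : j != i by apply: contraTneq kji => ->; rewrite before_irr.
  rewrite before_total //; apply/negP => /B kij.
  by have := before_trans kij kji; rewrite before_irr.
have al0 : al != 0 by have := @param_neq0 1 0 isT; rewrite mul1r addr0.
apply/mnmP => i; have /eqP := E i; rewrite /spectrum R (inj_eq (addIr _)).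
rewrite (inj_eq (mulfI al0)) => /eqP /eqP.
wlog le : m k {E B R} / (m i <= k i)%N => [H|].
  by case/orP: (leq_total (m i) (k i)) => le; [|rewrite eq_sym]; move/H => ->.
by rewrite eq_sym -subr_eq0 -natrB // ((pcharf0P F).1 charF0) subn_eq0 => le'; lia.
Qed.

Definition joint_eigen (c : 'I_N -> F) f := forall i, xi i f = c i *: f.

(** A monomial of f lower than no other has its coefficient multiplied by its own spectrum, so
    [spectrum_inj] identifies it with m. Any other is lower than one of larger [weightQ], whence an
    induction downwards from the largest [weightQ] in f. *)
Lemma joint_eigen_supp c m f : joint_eigen (spectrum m) f ->
  forall k, k \in msupp f -> (k == m) || lower c k m.
Proof.
move=> Ef k; pose B := (\max_(k <- msupp f) weightQ k)%N.
have [d] := ubnP (B - weightQ k)%N; elim: d k => // d IH k dk kf.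
have leB l : l \in msupp f -> (weightQ l <= B)%N by move=> lf; apply: leq_bigmax_seq.
case: (hasP (s := msupp f) (a := lower c k)) => [|kmax].
  case=> l lf kl; have /IH : (B - weightQ l < d)%N.
    by have := leB _ lf; case/and3P: kl; lia.
  move=> /(_ lf) /orP[/eqP <-|lm]; first by rewrite kl orbT.
  by rewrite (lower_trans kl lm) orbT.
rewrite (spectrum_inj (m := k) (k := m)) ?eqxx // => i.
have := congr1 (mcoeff k) (Ef i); rewrite (@mcoeff_cherednik_max c); last first.
  by move=> l lf; apply/negP => kl; apply: kmax; exists l.
rewrite mcoeffZ; apply: mulIf; by rewrite -mcoeff_msupp.
Qed.

End Triangularity.

(** * Intertwiners *)

Section Intertwiners.
Variables (F : fieldType) (N : nat) (al : F).
Implicit Types (f g : {mpoly F[N]}) (i j : 'I_N) (s : 'S_N) (m : 'X_{1..N}).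

Local Notation sw i j := (msym (tperm i j)).
Local Notation xi := (cherednik al).

Lemma tperm_adj_l i i' j : i' = i.+1 :> nat -> (j < i)%N -> tperm i i' j = j.
Proof. by move=> E ji; rewrite tpermD // -(inj_eq val_inj) /=; lia. Qed.

Lemma tperm_adj_lt i i' j l : i' = i.+1 :> nat -> (j, l) != (i, i') -> (j, l) != (i', i) ->
  (tperm i i' j < tperm i i' l)%N = (j < l)%N.
Proof.
move=> E; rewrite !xpair_eqE -!(inj_eq val_inj) /=.
case: tpermP => [->|->|/eqP + /eqP +]; case: tpermP => [->|->|/eqP + /eqP +];
  rewrite -?(inj_eq val_inj) /=; lia.
Qed.

(** A relation of the degenerate affine Hecke algebra: an adjacent transposition reverses a single
    pair, so a single correction survives in [cherednik_msym]. *)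
Lemma cherednik_adj i i' f : i' = i.+1 :> nat ->
  sw i i' (xi i f) = xi i' (sw i i' f) + f.
Proof.
move=> E; rewrite cherednik_msym tpermL (big_pred1 i') ?msym_swK.
  rewrite big1 ?subr0 // => j /andP[ji]; rewrite tperm_adj_l //; lia.
move=> j; rewrite /= -(inj_eq val_inj) /=.
by case: tpermP => [->|->|/eqP + /eqP +]; rewrite -?(inj_eq val_inj) /=; lia.
Qed.

Lemma cherednik_adj' i i' f : i' = i.+1 :> nat ->
  sw i i' (xi i' f) = xi i (sw i i' f) - f.
Proof.
move=> E; apply: (can_inj (msym_swK i i')).
by rewrite msymB !msym_swK cherednik_adj // msym_swK addrK.
Qed.

Lemma cherednik_adjD i i' j f : i' = i.+1 :> nat -> j != i -> j != i' ->
  sw i i' (xi j f) = xi j (sw i i' f).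
Proof.
move=> E ji ji'; rewrite cherednik_msym tpermD 1?eq_sym // !big1 ?addr0 ?subr0 // => l.
  by case: tpermP => [->|->|/eqP + /eqP +] ;
    move: ji ji'; rewrite -?(inj_eq val_inj) /=; lia.
by case: tpermP => [->|->|/eqP + /eqP +] ;
    move: ji ji'; rewrite -?(inj_eq val_inj) /=; lia.
Qed.

Lemma intertwine i i' (c : 'I_N -> F) f : i' = i.+1 :> nat -> c i' != c i ->
  joint_eigen al c f ->
  joint_eigen al (fun j => c (tperm i i' j)) (sw i i' f + (c i' - c i)^-1 *: f).
Proof.
move=> E cN Ef j; rewrite cherednikD cherednikZ Ef.
have dN : c i' - c i != 0 by rewrite subr_eq0.
case: tpermP => [->|->|/eqP ji /eqP ji'].
- have -> : xi i (sw i i' f) = sw i i' (xi i' f) + f by rewrite cherednik_adj' // subrK.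
  rewrite Ef msymZ scalerDr !scalerA -addrA; congr (_ + _).
  by rewrite -{1}[f]scale1r -scalerDl; congr (_ *: _); field.
- have -> : xi i' (sw i i' f) = sw i i' (xi i f) - f by rewrite cherednik_adj // addrK.
  rewrite Ef msymZ scalerDr !scalerA -addrA; congr (_ + _).
  by rewrite -scaleN1r -scalerDl; congr (_ *: _); field.
- by rewrite -cherednik_adjD // Ef msymZ scalerDr !scalerA mulrC.
Qed.

(** Squares are the first power sum of use: \sum_i xi_i multiplies an eigenfunction of index m by al
    |m| - N (N - 1) / 2, which depends only on the degree. *)
Definition cherednik2 f := \sum_i xi i (xi i f).

Lemma cherednik2_lin (c : F) f g : cherednik2 (c *: f + g) = c *: cherednik2 f + cherednik2 g.
Proof.
rewrite /cherednik2 scaler_sumr -big_split /=; apply: eq_bigr => i _.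
by rewrite !cherednik_lin.
Qed.

Lemma cherednik2Z (c : F) f : cherednik2 (c *: f) = c *: cherednik2 f.
Proof. by rewrite /cherednik2 scaler_sumr; apply: eq_bigr => i _; rewrite !cherednikZ. Qed.

Lemma perm_adj_ind (P : 'S_N -> Prop) :
  P 1%g -> (forall s t, P s -> P t -> P (s * t)%g) ->
  (forall i i', i' = i.+1 :> nat -> P (tperm i i')) -> forall s, P s.
Proof.
move=> P1 PM Padj.
have Plt : forall d i j, (j = i + d.+1 :> nat)%N -> P (tperm i j).
  elim=> [|d IH] i j E; first by apply: Padj; rewrite E addn1.
  have kN : (i + d.+1 < N)%N by have := ltn_ord j; lia.
  pose k := Ordinal kN.
  have -> : tperm i j = (tperm k j * tperm i k * tperm k j)%g.
    have := tpermJ i k (tperm k j).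
    rewrite tpermL tpermD => [<-||]; last 2 first.
    - by rewrite -(inj_eq val_inj) /=; lia.
    - by rewrite -(inj_eq val_inj) /=; lia.
    by rewrite /conjg tpermV mulgA.
  have Pkj : P (tperm k j) by apply: Padj => /=; lia.
  by apply: (PM _ _ _ Pkj); apply: (PM _ _ Pkj); apply: IH.
move=> s; have [ts -> _] := prod_tpermP s.
elim: ts => [|[i j] ts IH]; first by rewrite big_nil.
rewrite big_cons; apply: (PM) => //=.
case: (ltngtP i j) => [ij|ji|/val_inj <-]; last by rewrite tperm1.
- by apply: (Plt (j - i).-1); lia.
- by rewrite tpermC; apply: (Plt (i - j).-1); lia.
Qed.

(** Adjacent transpositions suffice; there the squares of xi_i and xi_i' pick up the correction xi_i
    f + xi_i' f and its opposite. *)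
Lemma cherednik2_msym s f : msym s (cherednik2 f) = cherednik2 (msym s f).
Proof.
elim/perm_adj_ind: s f => [f|s t IHs IHt f|i i' E f].
- by rewrite !msym1m.
- by rewrite !msymMm IHs IHt.
have i'i : i' != i by rewrite -(inj_eq val_inj) /= E; lia.
rewrite msym_sum /cherednik2 (bigD1 i) //= (bigD1 i') //= [RHS](bigD1 i) //= [X in _ = _ + X](bigD1 i') //=.
rewrite !addrA; congr (_ + _); last first.
  by apply: eq_bigr => j /andP[ji ji']; rewrite !cherednik_adjD.
rewrite cherednik_adj // cherednik_adj // cherednik_adj' // cherednik_adj' // cherednikD raddfB /=.
by ring.
Qed.

Lemma cherednik2_joint_eigen (c : 'I_N -> F) f : joint_eigen al c f ->
  cherednik2 f = (\sum_i c i ^+ 2) *: f.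
Proof.
move=> Ef; rewrite /cherednik2 scaler_suml; apply: eq_bigr => i _.
by rewrite Ef cherednikZ Ef scalerA.
Qed.

End Intertwiners.

(** * The rotation that raises a composition *)

Section Rotation.
Variables (F : fieldType) (n : nat) (al : F).
Local Notation N := n.+1.
Implicit Types (f g : {mpoly F[N]}) (i j : 'I_N) (s : 'S_N) (m : 'X_{1..N}).

Local Notation sw i j := (msym (tperm i j)).
Local Notation xi := (cherednik al).

Definition cyc : 'S_N := perm (can_inj (@ord_predK N)).

Lemma cyc0 : cyc ord0 = ord_max.
Proof. by apply: val_inj; rewrite permE /= modn_small. Qed.

Lemma cycE i : (0 < i)%N -> cyc i = i.-1 :> nat.
Proof.
move=> i0; have iN := ltn_ord i; rewrite permE /=.
have -> : (i + N).-1 = (i.-1 + N)%N by lia.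
by rewrite modnDr modn_small //; lia.
Qed.

Lemma cyc_lt i j : (cyc i < cyc j)%N =
  if i == ord0 then false else if j == ord0 then true else (i < j)%N.
Proof.
have gt0 (l : 'I_N) : l != ord0 -> (0 < l)%N.
  by rewrite -(inj_eq val_inj) /= lt0n.
have [->|/gt0 i0] := eqVneq i ord0; have [->|/gt0 j0] := eqVneq j ord0;
  rewrite ?cyc0 ?cycE //=; have := ltn_ord i; have := ltn_ord j; lia.
Qed.

Lemma divdiff_mul_X i j f : i != j -> divdiff i j ('X_j * f) = 'X_j * divdiff i j f - sw i j f.
Proof.
move=> ij; apply: divdiffE => //; rewrite mulrBr mulrCA divdiffP msymM msymXU tpermR.
ring.
Qed.

Lemma tau_mul_Xmax i j f : i != ord_max -> j != ord_max ->
  tau i j ('X_ord_max * f) = 'X_ord_max * tau i j f.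
Proof.
move=> iM jM; rewrite /tau divdiff_mul_sym; first by ring.
by rewrite msymXU tpermD.
Qed.

Lemma ltn_ord_max i : (i < @ord_max n)%N = (i != ord_max).
Proof. by have := ltn_ord i; rewrite -(inj_eq val_inj) /=; lia. Qed.

Lemma cherednik_mul_Xmax i f : i != ord_max ->
  xi i ('X_ord_max * f) = 'X_ord_max * (xi i f - sw i ord_max f).
Proof.
move=> iM; rewrite !cherednikE mderivM mderivX mnm1E eq_sym (negPf iM) scale0r mul0r add0r.
rewrite (bigD1 ord_max) //= [in RHS](bigD1 ord_max) //=.
rewrite (eq_bigr (fun j => 'X_ord_max * tau i j f)); last first.
  by move=> j jM; rewrite tau_mul_Xmax.
rewrite -mulr_sumr /tau divdiff_mul_X //; move: iM; rewrite -ltn_ord_max => iM.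
rewrite ltnNge (ltnW iM) /= -!mul_mpolyC; ring.
Qed.

Lemma cherednik_max_mul_Xmax f :
  xi ord_max ('X_ord_max * f) = 'X_ord_max *
    (xi ord_max f + al *: f + \sum_(j | j != ord_max) sw ord_max j f).
Proof.
rewrite !cherednikE mderivM mderivX mnm1E eqxx scale1r.
rewrite (_ : (U_(ord_max) - U_(ord_max))%MM = 0%MM); last first.
  by apply/mnmP => i; rewrite mnmBE subnn mnmE.
rewrite mpolyX0 mul1r (bigD1 ord_max) //= tauii add0r.
rewrite (eq_bigr (fun j => 'X_ord_max * (tau ord_max j f + sw ord_max j f))); last first.
  move=> j jM; rewrite /tau ltn_ord_max jM divdiffC.
  rewrite divdiff_mul_X // [divdiff ord_max j f]divdiffC [tperm j _]tpermC; ring.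
rewrite -mulr_sumr big_split /= [in RHS](bigD1 ord_max) //= tauii add0r.
rewrite -!mul_mpolyC; ring.
Qed.

Definition raise f := 'X_ord_max * msym cyc f.

(** [cyc] reverses only the pairs containing 0, so conjugation by it leaves one transposition for i
    != 0 and all those involving 0 for i = 0. Moving the last variable past the operator produces
    exactly these terms, plus al when i = 0. *)
Lemma joint_eigen_raise (c : 'I_N -> F) f : joint_eigen al c f ->
  forall i, xi (cyc i) (raise f) = (c i + (i == ord0)%:R * al) *: raise f.
Proof.
move=> Ef i; rewrite /raise; case: eqVneq => [->|i0].
  have S : \sum_(j : 'I_N | (@ord0 n < j)%N && (cyc j < cyc ord0)%N) msym cyc (sw ord0 j f) =
      \sum_(j | j != ord_max) sw ord_max j (msym cyc f).
    rewrite [RHS](reindex_inj (@perm_inj _ cyc)) /=.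
    apply: eq_big => [j|j _]; last by rewrite msym_sw cyc0.
    rewrite cyc0 -ltn_ord_max /=; case: posnP => [j0|] //=.
    by rewrite (_ : j = ord0) ?cyc0 /= ?ltnn //; apply: val_inj.
  have := congr1 (msym cyc) (Ef ord0); rewrite cherednik_msym msymZ S.
  rewrite [X in _ - X]big1 => [|j]; last by rewrite ltn0.
  rewrite subr0 cyc0 cherednik_max_mul_Xmax mul1r scalerAr scalerDl => <-.
  by rewrite addrAC.
have iM : cyc i != ord_max by rewrite -cyc0 (inj_eq perm_inj).
rewrite cherednik_mul_Xmax // mul0r addr0 scalerAr; congr (_ * _).
rewrite -msymZ -Ef cherednik_msym big1 ?addr0 => [|j]; last first.
  case/andP => ij; rewrite cyc_lt (negPf i0); case: eqP => // _ ji.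
  by have := ltn_trans ij ji; rewrite ltnn.
rewrite (big_pred1 ord0) => [|j /=]; first by rewrite msym_sw cyc0.
rewrite cyc_lt (negPf i0); have [->|j0] := eqVneq j ord0; last by case: ltngtP.
by rewrite andbT lt0n; move: i0; rewrite -(inj_eq val_inj).
Qed.

Definition raise_mnm m : 'X_{1..N} := (U_(ord_max) + [multinom m (cyc^-1 j)%g | j < N])%MM.

Lemma raise_mnmE m i : raise_mnm m (cyc i) = (m i + (i == ord0))%N.
Proof.
by rewrite mnmDE mnm1E mnmE permK -cyc0 (inj_eq perm_inj) eq_sym addnC.
Qed.

(** Moved to the last index, position 0 loses the ties it used to win; the unit added to its
    exponent makes up for this. *)
Lemma before_raise_mnm m i j : before (raise_mnm m) (cyc j) (cyc i) = before m j i.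
Proof.
rewrite /before !raise_mnmE cyc_lt; case: (eqVneq i ord0) => [->|i0].
  by case: (eqVneq j ord0) => [->|j0] /=; lia.
case: (eqVneq j ord0) => [->|j0] /=; last lia.
by move: i0; rewrite -(inj_eq val_inj) /=; lia.
Qed.

Lemma spectrum_raise_mnm m i : spectrum al (raise_mnm m) (cyc i) = spectrum al m i + (i == ord0)%:R * al.
Proof.
rewrite /spectrum raise_mnmE /rank (reindex_inj (@perm_inj _ cyc)) /=.
rewrite (eq_bigr (fun j => nat_of_bool (before m j i))) => [|j _].
  by rewrite natrD; ring.
by rewrite before_raise_mnm.
Qed.

End Rotation.

(** * Nonsymmetric Jack polynomials at (1, ..., 1) *)

Section Existence.
Variables (F : fieldType) (n : nat) (al : F).
Hypothesis charF0 : [pchar F] =i pred0.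
Hypothesis alP : jack_param al.
Local Notation N := n.+1.
Implicit Types (f g : {mpoly F[N]}) (i j : 'I_N) (s : 'S_N) (m : 'X_{1..N}).

Local Notation sw i j := (msym (tperm i j)).
Local Notation spec := (spectrum al).
Local Notation one := (fun _ : 'I_N => 1 : F).

(* v is the value at (1, ..., 1) of the nonsymmetric Jack polynomial of index m,
   normalized by its coefficient at m. *)
Definition nonsym_value m (v : F) :=
  exists f, [/\ joint_eigen al (spec m) f, f@_m = 1 & f.@[one] = v].

Lemma meval1_msym s f : (msym s f).@[one] = f.@[one].
Proof.
elim/mpolyind: f => [|c m f _ _ IH]; first by rewrite msym0.
rewrite msymD msymZ !mevalD !mevalZ IH msymX !mevalX.
by congr (_ * _ + _); rewrite !big1 // => i _; rewrite expr1n.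
Qed.

Lemma nonsym_value0 : nonsym_value 0%MM 1.
Proof.
exists 1; split; last 2 first.
- by rewrite mcoeff1 eqxx.
- by rewrite meval1.
move=> i; rewrite cherednikE -mpolyC1 mderivC mulr0 scaler0 add0r mpolyC1.
rewrite (eq_bigr (fun j => - (j < i)%N%:R%:MP)) => [|j _]; last first.
  have -> : tau i j (1 : {mpoly F[N]}) = - (j < i)%N%:R * 1.
    have [->|ij] := eqVneq i j; first by rewrite tauii ltnn oppr0 mul0r.
    rewrite /tau (divdiffE (g := 0)) ?mulr0 ?sub0r ?mulNr //.
    by rewrite msym1 subrr.
  by rewrite mulr1 mpolyC_nat.
rewrite sumrN -raddf_sum /= -natr_sum /spectrum mnm0E mulr0 sub0r scaleNr.
congr (- _); rewrite -alg_mpolyC; congr (_%:R *: _); apply: eq_bigr => j _.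
by rewrite /before !mnm0E ltnn eqxx.
Qed.

Lemma nonsym_value_raise_mnm m v : nonsym_value m v -> nonsym_value (raise_mnm m) v.
Proof.
case=> f [Ef fm fv]; exists (raise f); split.
- move=> i; by rewrite -(permKV (@cyc n) i) (joint_eigen_raise Ef) spectrum_raise_mnm.
- rewrite /raise mulrC /raise_mnm mcoeffMX mcoeff_sym -fm; congr (_@__).
  by apply/mnmP => i; rewrite !mnmE permK.
- by rewrite /raise mevalM mevalXU mul1r meval1_msym.
Qed.

Definition permute m s : 'X_{1..N} := [multinom m (s i) | i < N].

Lemma before_swap m i i' j l : i' = i.+1 :> nat -> m i != m i' ->
  before (permute m (tperm i i')) j l = before m (tperm i i' j) (tperm i i' l).
Proof.
move=> E mN; rewrite /before !mnmE.
have [jl|jl] := eqVneq (j, l) (i, i').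
  by case: jl => -> ->; rewrite tpermL tpermR; move: mN; lia.
have [jl'|jl'] := eqVneq (j, l) (i', i).
  by case: jl' => -> ->; rewrite tpermL tpermR; move: mN; lia.
by rewrite tperm_adj_lt.
Qed.

Lemma spectrum_swap m i i' : i' = i.+1 :> nat -> m i != m i' ->
  spec (permute m (tperm i i')) =1 (fun j => spec m (tperm i i' j)).
Proof.
move=> E mN j; rewrite /spectrum mnmE /rank; congr (_ - _%:R).
rewrite [RHS](reindex_inj (@perm_inj _ (tperm i i'))) /=.
by apply: eq_bigr => l _; rewrite before_swap.
Qed.

Lemma transfer_swap m i i' : i' != i -> (m i < m i')%N ->
  transfer i i' (permute m (tperm i i')) (m i' - m i) = m.
Proof.
move=> ii' mii'; have i'i : i != i' by rewrite eq_sym.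
apply/mnmP => j; rewrite transferE // !mnmE tpermL tpermR.
have [->|ji] := eqVneq j i; first by lia.
have [->|ji'] := eqVneq j i'; first by lia.
by rewrite tpermD // eq_sym.
Qed.

Lemma lower_swap c m i i' : (i < i')%N -> (m i < m i')%N ->
  lower c m (permute m (tperm i i')).
Proof.
move=> lii' mii'; have ii' : i' != i by rewrite -(inj_eq val_inj) /=; lia.
rewrite -{1}(transfer_swap ii' mii').
have i'i : i != i' by rewrite eq_sym.
by apply: lower_transfer => //; rewrite !mnmE tpermL tpermR ?lii' ?orbT //; lia.
Qed.

Lemma nonsym_value_swap m v i i' : i' = i.+1 :> nat -> (m i < m i')%N ->
  nonsym_value m v ->
  nonsym_value (permute m (tperm i i')) (v * (1 + (spec m i' - spec m i)^-1)).
Proof.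
move=> E mii' [f [Ef fm fv]].
have ii' : (i < i')%N by rewrite E.
have i'i : i' != i by rewrite -(inj_eq val_inj) /=; lia.
exists (sw i i' f + (spec m i' - spec m i)^-1 *: f); split.
- have mN : m i != m i' by lia.
  have := intertwine E (spectrum_neq charF0 alP m i'i) Ef.
  by move=> H j; rewrite H spectrum_swap.
(* The new leading coefficient comes from [sw i i' f] alone: m is lower than its swapped form, so
   the latter cannot occur in f. *)
- rewrite mcoeffD mcoeff_sym mcoeffZ [f@_(permute _ _)]memN_msupp_eq0.
    rewrite mulr0 addr0 -fm; congr (_@__).
    by apply/mnmP => j; rewrite !mnmE tpermK.
  apply/negP => /(joint_eigen_supp charF0 alP 0 Ef) /orP[/eqP H|H].
    by have /mnmP/(_ i) := H; rewrite mnmE tpermL => H'; rewrite H' ltnn in mii'.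
  have := lower_trans H (lower_swap 0 ii' mii').
  by rewrite /lower ltnn.
- by rewrite mevalD mevalZ meval1_msym fv; ring.
Qed.

(** The factor picked up on the way from the increasing rearrangement to m: each swap creates one
    inversion and permutes the spectrum, so the earlier factors are carried along unchanged. *)
Definition inversion_product m : F :=
  \prod_(x : 'I_N * 'I_N | (x.1 < x.2)%N && (m x.2 < m x.1)%N)
     (1 + (spec m x.1 - spec m x.2)^-1).

Lemma inversion_product_swap m i i' : i' = i.+1 :> nat -> (m i < m i')%N ->
  inversion_product (permute m (tperm i i')) =
  inversion_product m * (1 + (spec m i' - spec m i)^-1).
Proof.
move=> E mii'; have mN : m i != m i' by lia.
rewrite /inversion_product (bigD1 (i, i')) /=; last first.
  by rewrite !mnmE tpermL tpermR mii' E ltnSn.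
rewrite !spectrum_swap // tpermL tpermR mulrC; congr (_ * _).
pose h (x : 'I_N * 'I_N) := (tperm i i' x.1, tperm i i' x.2).
have hK : involutive h by case=> a b; rewrite /h /= !tpermK.
rewrite [RHS](reindex_inj (inv_inj hK)) /=; apply: eq_big => [[a b]|[a b] _] /=.
  rewrite !mnmE; have [ab|ab] := eqVneq (a, b) (i, i').
    by case: ab => -> ->; rewrite tpermL tpermR E ltnSn andbF /=; lia.
  have [ab'|ab'] := eqVneq (a, b) (i', i); last by rewrite tperm_adj_lt // andbT.
  by case: ab' => -> ->; rewrite tpermL tpermR E; lia.
by rewrite !spectrum_swap.
Qed.

Lemma permuteK m s : permute (permute m s) s^-1%g = m.
Proof. by apply/mnmP => i; rewrite !mnmE permKV. Qed.

Lemma perm_permute m s : perm_eq (permute m s) m.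
Proof.
apply/tuple_permP; exists s; congr val; apply: eq_from_tnth => i.
Qed.

(** Undoing a descent at adjacent positions lowers [weightQ], and the only rearrangement without
    such descents is m0. *)
Lemma perm_sorted_ind (P : 'X_{1..N} -> Prop) m0 : sorted leq m0 -> P m0 ->
  (forall m i i', i' = i.+1 :> nat -> (m i < m i')%N -> P m -> P (permute m (tperm i i'))) ->
  forall m, perm_eq m m0 -> P m.
Proof.
move=> m0s Pm0 PS m; have [d] := ubnP (weightQ m); elim: d m => // d IH m Qd mm0.
have [ms|] := boolP [forall i : 'I_N, forall i' : 'I_N, (i' == i.+1 :> nat) ==> (m i <= m i')%N].
  have sm : sorted leq m.
    apply/(sortedP 0%N) => k; rewrite size_tuple => kN.
    have kN' : (k < N)%N by exact: ltnW.
    have /forallP/(_ (Ordinal kN))/implyP/(_ (eqxx _)) := forallP ms (Ordinal kN').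
    by rewrite !(mnm_nth 0).
  suff -> : m = m0 by [].
  by apply: val_inj; apply: val_inj; apply: (sorted_eq leq_trans anti_leq).
rewrite negb_forall => /existsP[i]; rewrite negb_forall => /existsP[i'].
rewrite negb_imply -ltnNge => /andP[/eqP E mi'i].
pose m' := permute m (tperm i i').
have mE : m = permute m' (tperm i i') by rewrite -{1}(permuteK m (tperm i i')) tpermV.
have m'ii' : (m' i < m' i')%N by rewrite !mnmE tpermL tpermR.
have ii' : (i < i')%N by rewrite E.
rewrite mE; apply: PS => //; apply: IH.
  have := lower_swap 0 ii' m'ii'; rewrite -mE => /and3P[Q _ _].
  by rewrite -ltnS; apply: leq_trans Qd; rewrite ltnS.
exact: perm_trans (perm_permute _ _) mm0.
Qed.

Lemma weightQ_sorted_min m0 m : sorted leq m0 -> perm_eq m m0 -> (weightQ m0 <= weightQ m)%N.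
Proof.
move=> m0s; move: m; apply: perm_sorted_ind => // m i i' E mii' le.
have ii' : (i < i')%N by rewrite E.
by have /and3P[Q _ _] := lower_swap 0 ii' mii'; apply: leq_trans le (ltnW Q).
Qed.

Lemma nonsym_value_perm m0 v m : sorted leq m0 -> nonsym_value m0 v -> perm_eq m m0 ->
  nonsym_value m (v * inversion_product m).
Proof.
move=> m0s Vm0; move: m; apply: perm_sorted_ind => // [|m i i' E mii' Vm].
  rewrite /inversion_product big_pred0 ?mulr1 // => -[a b] /=; apply/negP => /andP[ab].
  rewrite ltnNge !(mnm_nth 0) (sorted_leq_nth leq_trans leqnn) ?inE ?size_tuple //.
  exact: ltnW.
by rewrite inversion_product_swap // mulrA; apply: nonsym_value_swap.
Qed.

End Existence.

(** * Column lengths of decreasing sequences *)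

Section SortedCount.
Implicit Types (s la : seq nat).

(** The count is the length of column v of the diagram: column v is longer than k exactly when row k
    is longer than v. *)
Lemma sorted_geq_count s v k : sorted geq s ->
  (k < count (fun x => v < x)%N s)%N = (v < nth 0%N s k)%N.
Proof.
elim: s k => [|x s IH] k /=; first by rewrite nth_nil !ltn0.
move=> ps; have ss := path_sorted ps.
have [vx|xv] := ltnP v x; first by case: k => [|k] /=; rewrite ?add1n ?ltnS ?IH ?vx.
have le y : y \in s -> (y <= v)%N.
  move=> ys; apply: leq_trans xv.
  by have /allP/(_ y ys) := order_path_min (rev_trans leq_trans) ps.
have -> : count (fun x => v < x)%N s = 0%N.
  apply/eqP; rewrite -leqn0 leqNgt -has_count; apply/hasPn => y /le.
  by rewrite -leqNgt.
rewrite add0n ltn0; case: k => [|k] /=; first by rewrite ltnNge xv.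
apply/esym/negbTE; rewrite -leqNgt; have [ks|sk] := ltnP k (size s).
  exact/le/mem_nth.
by rewrite nth_default.
Qed.

Lemma sorted_geq_predn s : sorted geq s -> sorted geq (map predn s).
Proof. by apply: homo_sorted => x y /=; lia. Qed.

Lemma count_predn_gt0 s : count (fun x => 0 < x)%N (map predn s) = count (fun x => 1 < x)%N s.
Proof. by rewrite count_map; apply: eq_count => x /=; lia. Qed.

Lemma nth_predn s i : nth 0%N (map predn s) i = (nth 0%N s i).-1.
Proof.
have [is_|si] := ltnP i (size s); first by rewrite (nth_map 0%N).
by rewrite !nth_default ?size_map.
Qed.

Lemma count_drop_gt0 s i : sorted geq s -> (i < count (fun x => 0 < x)%N s)%N ->
  count (fun x => 0 < x)%N (drop i.+1 s) = (count (fun x => 0 < x)%N s - i.+1)%N.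
Proof.
move=> ss il; have is_ : (i < size s)%N by apply: leq_trans il (count_size _ _).
rewrite -{2}(cat_take_drop i.+1 s) count_cat.
have -> : count (fun x => 0 < x)%N (take i.+1 s) = i.+1; last by lia.
have sz : size (take i.+1 s) = i.+1 by rewrite size_takel.
rewrite -[RHS]sz; apply/eqP; rewrite -all_count; apply/(all_nthP 0%N) => k.
rewrite sz => ki; rewrite nth_take // -sorted_geq_count //.
exact: leq_trans il.
Qed.

End SortedCount.

(** * Hooks, contents and stabilizers when a column is removed *)

Section Columns.
Variables (F : fieldType) (al : F).
Implicit Types (s la : seq nat).

Lemma boxprodE (A : comPzRingType) la (f : nat -> nat -> A) :
  boxprod la f = \prod_(0 <= i < size la) \prod_(0 <= j < nth 0%N la i) f i j.
Proof. by rewrite /boxprod big_mkord; apply: eq_bigr => i _; rewrite big_mkord. Qed.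

Lemma prod_nat_trunc (A : comPzRingType) (G : nat -> A) k m : (k <= m)%N ->
  \prod_(0 <= i < m) (if (i < k)%N then G i else 1) = \prod_(0 <= i < k) G i.
Proof. by move=> km; rewrite (big_nat_widen _ _ _ _ _ km) -big_mkcond. Qed.

(** Removing the first column keeps the arm and leg of every other box, while its own box in row i
    has arm la_i - 1 and leg l - i - 1. Since la may end with zeros, l is a count and not the
    size. *)
Lemma hook_column la : sorted geq la ->
  let l := count (fun x => 0 < x)%N la in
  hook al la = (\prod_(0 <= i < l) (al * (nth 0%N la i).-1%:R + (l - i)%:R))
               * hook al (map predn la).
Proof.
move=> sla l; rewrite /hook !boxprodE size_map.
rewrite -(prod_nat_trunc _ (count_size (fun x => 0 < x)%N la)) -/l -big_split /=.
apply: eq_big_nat => i /andP[_ ila]; rewrite nth_predn.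
have E j : leg la i j.+1 = leg (map predn la) i j.
  by rewrite /leg -map_drop count_map; apply: eq_count => x /=; lia.
rewrite sorted_geq_count //; case: posnP => [->|l0]; first by rewrite mul1r /= !big_nil.
rewrite -{1}(prednK l0) big_nat_recl //; congr (_ * _).
  rewrite /arm /leg subn1 count_drop_gt0 -/l ?sorted_geq_count //.
  have il : (i < l)%N by rewrite sorted_geq_count.
  by rewrite -addrA natr1 -subSn.
by apply: eq_bigr => j _; rewrite E /arm nth_predn; congr (_ * _%:R + _ + _); lia.
Qed.

(** Contents depend on the column index, so the boxes split off here are the last ones of the rows,
    not those of the first column. *)
Lemma content_column (x : F) la : sorted geq la ->
  let l := count (fun x => 0 < x)%N la in
  boxprod la (fun i j => x + (al * j%:R - i%:R)) =
    (\prod_(0 <= i < l) (x + (al * (nth 0%N la i).-1%:R - i%:R)))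
    * boxprod (map predn la) (fun i j => x + (al * j%:R - i%:R)).
Proof.
move=> sla l; rewrite !boxprodE size_map.
rewrite -(prod_nat_trunc _ (count_size (fun x => 0 < x)%N la)) -/l -big_split /=.
apply: eq_big_nat => i /andP[_ ila]; rewrite nth_predn.
rewrite sorted_geq_count //; case: posnP => [->|l0]; first by rewrite mul1r /= !big_nil.
by rewrite -{1}(prednK l0) big_nat_recr //= mulrC.
Qed.

(* The order of the stabilizer of la under permutations, if all parts are < B. *)
Definition stab_order B la : nat := (\prod_(v < B) (count_mem (val v) la)`!)%N.

(** Lowering the parts merges the size la - l zeros and the l - k ones into size la - k zeros; the
    other multiplicities are only shifted. *)
Lemma stab_order_column B la : let l := count (fun x => 0 < x)%N la in
  let k := count (fun x => 1 < x)%N la in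
  (stab_order B.+2 la * (size la - k)`! =
   stab_order B.+1 (map predn la) * (size la - l)`! * (l - k)`!)%N.
Proof.
move=> l k; rewrite /stab_order !big_ord_recl /=.
have c0 : count_mem 0%N la = (size la - l)%N.
  rewrite /l -(count_predC (fun x => 0 < x)%N la) addKn.
  by apply: eq_count => x /=; lia.
have c1 : count_mem 1%N la = (l - k)%N.
  rewrite /l /k; elim: (la) => //= x s IH.
  have : (count (fun x => 1 < x) s <= count (fun x => 0 < x) s)%N.
    by apply: sub_count => y /=; lia.
  by move: x => [|[|x]] /=; lia.
have c2 : count_mem 0%N (map predn la) = (size la - k)%N.
  rewrite /k count_map -(count_predC (fun x => 1 < x)%N la) addKn.
  by apply: eq_count => x /=; lia.
rewrite c0 c1 c2.
under [X in (_ = _ * X * _ * _)%N]eq_bigr => v _.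
  rewrite count_map (eq_count (a2 := pred1 v.+2)); last by move=> x; rewrite /= /bump /=; lia.
  over.
rewrite [X in (_ * (_ * X) * _)%N](eq_bigr (fun v : 'I_B => (count_mem v.+2 la)`!)) //=.
nia.
Qed.

End Columns.

(** * The inversion product of one added column *)

Section Evaluation.
Variables (F : fieldType) (n : nat) (al : F).
Hypothesis charF0 : [pchar F] =i pred0.
Hypothesis alP : jack_param al.
Local Notation N := n.+1.
Implicit Types (i j : 'I_N) (m : 'X_{1..N}) (s la a : seq nat).
Local Notation spec := (spectrum al).

Definition mnm_of s : 'X_{1..N} := [multinom nth 0%N s i | i < N].

Lemma val_mnm_of s : size s = N -> mnm_of s = s :> seq nat.
Proof.
move=> sN; apply: (@eq_from_nth _ 0%N); rewrite size_tuple ?sN // => i iN.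
by rewrite -(mnm_nth 0%N _ (Ordinal iN)) mnmE.
Qed.

Lemma raise_mnm_of x s : size s = n -> raise_mnm (mnm_of (x :: s)) = mnm_of (rcons s x.+1).
Proof.
move=> sn; apply/mnmP => i; rewrite -(permKV (@cyc n) i).
move: ((cyc n)^-1 i)%g => {}i; rewrite raise_mnmE !mnmE nth_rcons sn.
have [->|i0] := eqVneq i ord0; first by rewrite cyc0 /= ltnn eqxx addn1.
have ip : (0 < i)%N by rewrite lt0n; move: i0; rewrite -(inj_eq val_inj).
have iN := ltn_ord i; rewrite cycE // addn0 -{1}(prednK ip) /=.
by rewrite ifT //; lia.
Qed.

Lemma iter_raise_mnm s a : (size s + size a)%N = N ->
  iter (size s) (@raise_mnm n) (mnm_of (s ++ a)) = mnm_of (a ++ map succn s).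
Proof.
elim: s a => [|x s IH] a; first by rewrite cats0.
rewrite [size _]/= addSn => -[sa]; rewrite iterSr cat_cons raise_mnm_of ?size_cat //.
by rewrite rcons_cat IH ?size_rcons ?addnS ?sa // cat_rcons.
Qed.

Lemma nonsym_value_iter k m v : nonsym_value al m v -> nonsym_value al (iter k (@raise_mnm n) m) v.
Proof. by move=> V; elim: k => //= k IH; apply: nonsym_value_raise_mnm. Qed.

Lemma rank_lt m i : (rank m i < N)%N.
Proof.
rewrite /rank (bigD1 i) //= before_irr add0n.
apply: (@leq_ltn_trans (\sum_(j | j != i) 1)); first by apply: leq_sum => j _; case: before.
by rewrite sum1_card cardC1 card_ord.
Qed.

Definition rank_ord m i : 'I_N := Ordinal (rank_lt m i).

Lemma rank_ord_inj m : injective (rank_ord m).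
Proof.
move=> i j /(congr1 val) /= E; apply/eqP; apply: contraT => ij.
have [b|] := boolP (before m i j); first by have := rank_before b; rewrite E ltnn.
by rewrite -before_total 1?eq_sym // => b; have := rank_before b; rewrite E ltnn.
Qed.

Lemma count_mnm m (P : pred nat) : count P m = (\sum_i P (m i))%N.
Proof.
rewrite -sum1_count big_tuple /= big_mkcond /=; apply: eq_bigr => i _.
by rewrite mnm_tnth; case: (P _).
Qed.

Lemma nth_rank s m i : sorted geq s -> perm_eq m s -> nth 0%N s (rank m i) = m i.
Proof.
move=> ss ms; have ssz : size s = N by rewrite -(perm_size ms) size_tuple.
apply/eqP; rewrite eqn_leq; apply/andP; split.
  rewrite leqNgt -sorted_geq_count // -(seq.permP ms) count_mnm -leqNgt.
  by apply: leq_sum => j _; rewrite /before; case: ltnP.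
case mi: (m i) => [//|v]; rewrite -sorted_geq_count // -(seq.permP ms) count_mnm.
rewrite /rank (bigD1 i) //= before_irr add0n [X in (_ < X)%N](bigD1 i) //= mi ltnSn add1n ltnS.
by apply: leq_sum => j _; rewrite /before mi; case: ltngtP => //=; case: (v < m j)%N => //; lia.
Qed.

Lemma prod_telescope (c : F) (k m : nat) : (k <= m)%N ->
  (forall j : nat, (k <= j <= m)%N -> c + j%:R != 0) ->
  \prod_(k <= j < m) (1 + (c + j%:R)^-1) = (c + m%:R) / (c + k%:R).
Proof.
elim: m => [|m IH] km H.
  have k0 : k = 0%N by lia.
  by rewrite k0 big_geq // divff // H // k0.
have m0 : c + m.+1%:R != 0 by apply: H; lia.
have [E|kN] := eqVneq k m.+1; first by rewrite E big_geq // divff.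
have m1 : c + m%:R != 0 by apply: H; lia.
have k0 : c + k%:R != 0 by apply: H; lia.
rewrite big_nat_recr /=; last by lia.
rewrite IH => [||j jm]; [|lia|by apply: H; lia].
by rewrite -natr1; field; rewrite ?m1 ?k0.
Qed.

(* The rearrangement (s_(l-1), ..., s_0, 0, ..., 0) of s: l rotations turn it into
   the increasing rearrangement of s + 1^l. *)
Lemma inversion_product_block s l : sorted geq s -> size s = N -> (l <= N)%N ->
  drop l s = nseq (N - l) 0%N ->
  inversion_product al (mnm_of (rev (take l s) ++ drop l s)) =
  \prod_(0 <= r < count (fun x => 0 < x)%N s)
     ((al * (nth 0%N s r)%:R - r%:R + N%:R) / (al * (nth 0%N s r)%:R - r%:R + l%:R)).
Proof.
move=> ss ssz lN sl; set w := mnm_of _.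
have szt : size (take l s) = l by rewrite size_takel ?ssz.
have perm_w : perm_eq w s.
  rewrite val_mnm_of ?size_cat ?size_rev ?szt ?size_drop ?ssz; last by lia.
  by rewrite -[X in perm_eq _ X](cat_take_drop l s) perm_cat2r perm_rev.
have wE i : w i = nth 0%N (rev (take l s)) i.
  rewrite mnmE nth_cat size_rev szt; case: ltnP => // li.
  by rewrite sl nth_nseq nth_default ?size_rev ?szt //; case: ifP.
have w0 i : (l <= i)%N -> w i = 0%N by move=> li; rewrite wE nth_default ?size_rev ?szt.
have wl i : (0 < w i)%N -> (i < l)%N.
  by move=> wi; rewrite ltnNge; apply: contraL wi => /w0 ->.
have wmono i j : (i < j)%N -> (j < l)%N -> (w i <= w j)%N.
  move=> ij jl; rewrite !wE; apply: (sorted_leq_nth leq_trans leqnn).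
  - by rewrite rev_sorted take_sorted.
  - by rewrite inE size_rev szt (ltn_trans ij).
  - by rewrite inE size_rev szt.
  - exact: ltnW.
have rank_tail j : (l <= j)%N -> rank w j = j.
  move=> lj; rewrite /rank (eq_bigr (fun k : 'I_N => nat_of_bool (k < j)%N)); last first.
    move=> k _; rewrite /before [w j]w0 // lt0n eq_sym; congr nat_of_bool.
    case: (eqVneq (w k) 0%N) => //= wk; apply/esym.
    by apply: leq_trans lj; apply: wl; rewrite lt0n.
  rewrite (eq_bigr (fun k : 'I_N => if (k < j)%N then 1 else 0)%N); last first.
    by move=> k _; case: ltnP.
  rewrite -(big_mkord xpredT (fun k => if (k < j)%N then 1 else 0)%N) -big_mkcond.
  by rewrite -(big_nat_widen _ _ _ xpredT) ?(ltnW (ltn_ord j)) // sum_nat_const_nat subn0 muln1.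
(* By [rank_tail] a rank r >= l is already taken by position r; injectivity of the rank would give i
   = r >= l, against [wl]. *)
have rank_head i : (0 < w i)%N -> (rank w i < l)%N.
  move=> wi; rewrite ltnNge; apply/negP => lr.
  have := @rank_ord_inj w (rank_ord w i) i.
  have E : rank w (rank_ord w i) = rank w i by rewrite rank_tail.
  have /rank_ord_inj E' : rank_ord w (rank_ord w i) = rank_ord w i by apply: val_inj.
  by move: (wl _ wi); rewrite -{1}E' /= ltnNge lr.
rewrite /inversion_product -(pair_big_dep xpredT (fun i j => (i < j)%N && (w j < w i)%N)
  (fun i j => 1 + (spec w i - spec w j)^-1)) /=.
rewrite (eq_bigr (fun i => if (0 < w i)%N then
   (spec w i + N%:R) / (spec w i + l%:R) else 1)); last first.
  move=> i _; case: ifP => [wi|wi]; last by rewrite big_pred0 // => j; lia.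
  have il := wl i wi; have rl := rank_head i wi.
  (* The first l exponents increase weakly and the others vanish, so an inversion pairs a positive
     w_i with some j >= l; there the spectrum is -j, and the product over j telescopes. *)
  rewrite (eq_bigl (fun j : 'I_N => (l <= j)%N)); last first.
    move=> j; case: (leqP l j) => lj; first by rewrite w0 //; lia.
    case: (ltnP i j) => //= ij; have := wmono _ _ ij lj; lia.
  rewrite (eq_bigr (fun j : 'I_N => 1 + (spec w i + (j : nat)%:R)^-1)); last first.
    by move=> j lj; rewrite [in X in _ - X]/spectrum w0 // rank_tail // mulr0 sub0r opprK.
  rewrite -(big_mkord (fun j : nat => l <= j)%N (fun j : nat => 1 + (spec w i + j%:R)^-1)).
  rewrite (@big_cat_nat _ _ _ l) //= big_nat_cond big_pred0 ?mul1r; last by move=> j; lia.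
  rewrite big_nat_cond (eq_bigl (fun j : nat => l <= j < N)%N) -?big_nat; last by move=> j; lia.
  have H (j : nat) : (l <= j)%N -> spec w i + j%:R != 0.
    move=> lj; have := @param_neq0 _ al charF0 alP (w i) (j - rank w i) ltac:(lia).
    by rewrite natrB ?(leq_trans (ltnW rl)) // /spectrum mulrC addrA addrAC.
  by rewrite prod_telescope // => j /andP[lj _]; apply: H.
rewrite (eq_bigr (fun i => let r := rank_ord w i in if (0 < nth 0%N s r)%N then
   (al * (nth 0%N s r)%:R - r%:R + N%:R) / (al * (nth 0%N s r)%:R - r%:R + l%:R) else 1)); last first.
  by move=> i _; rewrite /= nth_rank.
rewrite -(reindex_inj (@rank_ord_inj w) (P := xpredT) (F := fun r : 'I_N =>
  if (0 < nth 0%N s r)%N then (al * (nth 0%N s r)%:R - r%:R + N%:R) /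
     (al * (nth 0%N s r)%:R - r%:R + l%:R) else 1)) /=.
rewrite -(prod_nat_trunc _ (count_size (fun x => 0 < x)%N s)) ssz big_mkord.
by apply: eq_bigr => r _; rewrite sorted_geq_count.
Qed.

End Evaluation.

(** * The value at (1, ..., 1) for an increasing composition *)

Section IncreasingValue.
Variables (F : fieldType) (n : nat) (al : F).
Hypothesis charF0 : [pchar F] =i pred0.
Hypothesis alP : jack_param al.
Local Notation N := n.+1.
Local Notation pos := (fun x => 0 < x)%N.

Lemma prod_subn_fact k l m : (k <= l <= m)%N ->
  (\prod_(k <= i < l) (m - i) * (m - l)`! = (m - k)`!)%N.
Proof.
case/andP; elim: l => [|l IH] kl lm; first by rewrite big_geq // mul1n; congr (_`!); lia.
have [E|kNl] := eqVneq k l.+1; first by rewrite E big_geq // mul1n.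
rewrite big_nat_recr /=; last by lia.
rewrite -IH; [|lia|lia]; rewrite -mulnA; congr (_ * _)%N.
by rewrite -(subnSK lm) factS.
Qed.

Lemma drop_count_pos (la : seq nat) : sorted geq la ->
  drop (count pos la) la = nseq (size la - count pos la) 0%N.
Proof.
move=> sla; apply: (@eq_from_nth _ 0%N); first by rewrite size_drop size_nseq.
move=> i _; rewrite nth_drop nth_nseq; case: ifP => _ //; apply/eqP;
  by rewrite -leqn0 leqNgt -sorted_geq_count // -leqNgt leq_addr.
Qed.

Lemma natr_neq0 k : (0 < k)%N -> k%:R != 0 :> F.
Proof. by rewrite ((pcharf0P F).1 charF0) -lt0n. Qed.

(** As N! / [stab_order] counts the distinct rearrangements of la, this says, denominators cleared,
    that the symmetrization normalized to leading coefficient 1 takes the value R_la(N) / h_la. B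
    only bounds the parts. *)
Lemma nonsym_value_increasing (la : seq nat) B : sorted geq la -> size la = N ->
  all (fun x => x <= B)%N la ->
  exists v, nonsym_value al (mnm_of n (rev la)) v /\
    v * hook al la * N`!%:R =
    (stab_order B.+1 la)%:R * boxprod la (fun i j => N%:R + (al * j%:R - i%:R)).
Proof.
have [d] := ubnP (sumn la); elim: d la B => // d IH la B sd sla szla laB.
set l := count pos la; have [l0|lpos] := posnP l.
  have laE : la = nseq N 0%N.
    by rewrite -(cat_take_drop l la) drop_count_pos // -/l l0 take0 subn0 szla.
  exists 1; split.
    rewrite (_ : mnm_of _ _ = 0%MM); first exact: nonsym_value0.
    by apply/mnmP => i; rewrite laE rev_nseq mnmE nth_nseq mnm0E ltn_ord.
  have row i : nth 0%N la i = 0%N by rewrite laE nth_nseq; case: ifP.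
  rewrite /hook !boxprodE !big1 ?mul1r ?mulr1 => [|i _|i _]; last 2 first.
  - by rewrite row big_geq.
  - by rewrite row big_geq.
  congr _%:R; rewrite /stab_order big_ord_recl /= laE count_nseq /= mul1n big1 ?muln1 // => i _.
  by rewrite count_nseq.
have [B' BE] : exists B', B = B'.+1.
  case: B laB => [|B']; last by exists B'.
  move/allP => la0; move: lpos; rewrite -has_count => /hasP[x /la0].
  by case: x.
set nu := map predn la; have snu := sorted_geq_predn sla : sorted geq nu.
have sznu : size nu = N by rewrite size_map.
have lN : (l <= N)%N by rewrite -szla count_size.
have nuB : all (fun x => x <= B')%N nu.
  by rewrite all_map; apply: sub_all laB => x /=; rewrite BE; lia.
have sumE : (sumn la = sumn nu + l)%N.
  by rewrite /nu /l; elim: (la) => //= x s ->; case: x => [|x] /=; lia.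
have [|v [Vv vE]] := IH nu B' _ snu sznu nuB; first by lia.
have dropnu : drop l nu = nseq (N - l) 0%N.
  by rewrite /nu -map_drop drop_count_pos // -/l szla map_nseq.
set w := mnm_of n (rev (take l nu) ++ drop l nu).
exists (v * inversion_product al w); split.
  have -> : mnm_of n (rev la) = iter l (@raise_mnm n) w.
    have szt : size (rev (take l nu)) = l by rewrite size_rev size_takel ?sznu.
    rewrite -{1}szt /w iter_raise_mnm ?szt ?size_drop ?sznu ?subnKC //.
    congr mnm_of; rewrite -(cat_take_drop l la) rev_cat drop_count_pos // -/l szla.
    rewrite rev_nseq dropnu map_rev /nu -map_take -map_comp; congr (_ ++ rev _).
    rewrite -[LHS]map_id; apply/eq_in_map => x /(nthP 0%N)[i].
    rewrite size_takel ?szla // => il <-; rewrite nth_take //= prednK //.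
    by rewrite -sorted_geq_count.
  apply: nonsym_value_iter; apply: (nonsym_value_perm charF0 alP _ Vv).
    by rewrite val_mnm_of ?size_rev // rev_sorted.
  rewrite /w !val_mnm_of ?size_rev ?size_cat ?size_rev ?size_takel ?size_drop ?sznu ?subnKC //.
  by rewrite perm_sym perm_rev -{1}(cat_take_drop l nu) perm_cat2r perm_sym perm_rev.
rewrite /w inversion_product_block //.
set k := count pos nu; have kE : k = count (fun x => 1 < x)%N la by apply: count_predn_gt0.
have kl : (k <= l)%N by rewrite kE; apply: sub_count => x /=; lia.
rewrite hook_column // content_column // -/l -/nu.
have nu0 i : (k <= i)%N -> nth 0%N nu i = 0%N.
  move=> ki; apply/eqP; rewrite -leqn0 leqNgt -sorted_geq_count // -leqNgt //.
(* Rows of length 1 have nu_i = 0; their first-column factors l - i, for k <= i < l, multiply to (l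
   - k)!. *)
have hE : \prod_(0 <= i < l) (al * (nth 0%N la i).-1%:R + (l - i)%:R) =
  \prod_(0 <= r < k) (al * (nth 0%N nu r)%:R - r%:R + l%:R) * (l - k)`!%:R.
  rewrite (@big_cat_nat _ _ _ k) //=; congr (_ * _).
    apply: eq_big_nat => i /andP[_ ik]; rewrite nth_predn natrB ?(leq_trans (ltnW ik)) //.
    by ring.
  rewrite -(@prod_subn_fact k l l) ?kl ?leqnn // subnn muln1 natr_prod.
  by apply: eq_big_nat => i /andP[ki _]; rewrite -nth_predn nu0 // mulr0 add0r.
(* Likewise the row ends of content -i, for k <= i < l, contribute (N - k)! / (N - l)!. *)
have rE : (\prod_(0 <= i < l) (N%:R + (al * (nth 0%N la i).-1%:R - i%:R))) * (N - l)`!%:R =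
  \prod_(0 <= r < k) (al * (nth 0%N nu r)%:R - r%:R + N%:R) * (N - k)`!%:R.
  rewrite (@big_cat_nat _ _ _ k) //= -mulrA; congr (_ * _).
    by apply: eq_big_nat => i _; rewrite nth_predn addrC.
  rewrite -(@prod_subn_fact k l N) ?kl // natrM natr_prod; congr (_ * _).
  apply: eq_big_nat => i /andP[ki il]; rewrite -nth_predn nu0 // mulr0 sub0r.
  by rewrite natrB // (leq_trans (ltnW il)).
have := stab_order_column B' la; rewrite -/l -kE szla -/nu -BE => sE.
have C0 : \prod_(0 <= r < k) (al * (nth 0%N nu r)%:R - r%:R + l%:R) != 0.
  rewrite prodf_seq_neq0; apply/allP => r; rewrite mem_index_iota => /andP[_ rk] /=.
  have := @param_neq0 _ al charF0 alP (nth 0%N nu r) (l - r) ltac:(lia).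
  by rewrite natrB ?(leq_trans (ltnW rk)) // mulrC addrA addrAC.
rewrite -BE in vE; rewrite prodf_div hE; move: C0 rE sE {hE} vE.
(* A / C is the inversion product: C cancels against the hook factor of the column, A is the content
   factor, and the remaining factorials are those of [stab_order_column]. *)
set C := \prod_(0 <= r < k) _; set A := \prod_(0 <= r < k) _.
set P := \prod_(0 <= i < l) _ => C0 rE sE vE.
apply: (mulIf (natr_neq0 (fact_gt0 (N - l)))).
set h := hook al nu in vE *; set Nf := N`!%:R in vE *; set R := boxprod nu _ in vE *.
transitivity (A * (stab_order B nu * (N - l)`! * (l - k)`!)%:R * R).
  rewrite !natrM; transitivity ((v * h * Nf) * A * (l - k)`!%:R * (N - l)`!%:R).
    by field.
  rewrite vE; ring.
rewrite -sE natrM; transitivity ((stab_order B.+1 la)%:R * R * (A * (N - k)`!%:R)).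
  ring.
rewrite -rE; ring.
Qed.

End IncreasingValue.

(** * Symmetrization *)

Section CountPermutations.

Lemma bij_lift_perm n (j : 'I_n.+1) :
  {on [pred s : 'S_n.+1 | s ord0 == j], bijective (lift_perm ord0 j)}.
Proof.
pose ulsf (s : 'S_n.+1) k := odflt k (unlift (s ord0) (s (lift ord0 k))).
have ulsfK (s : 'S_n.+1) k : lift (s ord0) (ulsf s k) = s (lift ord0 k).
  rewrite /ulsf; have : s ord0 != s (lift ord0 k) by rewrite (inj_eq perm_inj) neq_lift.
  by case/unlift_some => k' -> ->.
have inj_ulsf s : injective (ulsf s).
  move=> k l E; apply: (@lift_inj _ ord0); apply: (@perm_inj _ s).
  by rewrite -!ulsfK E.
exists (fun s => perm (inj_ulsf s)) => [s _ | s].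
  by apply/permP => k; rewrite permE /ulsf lift_perm_lift lift_perm_id liftK.
rewrite inE => /eqP <-; apply/permP => k; case: (unliftP ord0 k) => [k'|] ->.
  by rewrite lift_perm_lift permE ulsfK.
by rewrite lift_perm_id.
Qed.

(** Fixing the image j of 0, which must satisfy b j = a 0, leaves the same problem on n elements
    ([bij_lift_perm]); the number of such j is the leading factor of one of the factorials. *)
Lemma card_perm_coloring B n (a b : 'I_n -> nat) :
  (forall v, \sum_i (a i == v) = \sum_i (b i == v))%N ->
  (forall i, a i < B)%N ->
  (\sum_(s : 'S_n) [forall i, b (s i) == a i] =
   \prod_(v < B) (\sum_i (a i == v))`!)%N.
Proof.
elim: n a b => [|n IH] a b ab aB.
  rewrite [RHS]big1 => [|v _]; last by rewrite big_ord0.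
  rewrite (eq_bigr (fun=> 1%N)); last by move=> s _; apply/eqP; rewrite eqb1; apply/forallP => -[].
  by rewrite sum1_card card_Sn.
rewrite (partition_big (fun s : 'S_n.+1 => s ord0) xpredT) //=.
pose T := (\prod_(v < B) (\sum_i (a (lift ord0 i) == v))`!)%N.
rewrite (eq_bigr (fun j => (b j == a ord0) * T)%N) => [|j _].
  rewrite -big_distrl /= -ab /T (bigD1 (Ordinal (aB ord0))) //= [RHS](bigD1 (Ordinal (aB ord0))) //=.
  rewrite mulnA; congr (_ * _)%N.
    by rewrite big_ord_recl eqxx add1n factS.
  apply: eq_bigr => v; rewrite -(inj_eq val_inj) /= => va.
  by rewrite big_ord_recl eq_sym (negPf va).
rewrite (reindex _ (bij_lift_perm j)) /=.
under eq_bigl do rewrite lift_perm_id eqxx.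
have [bj|bj] := eqVneq (b j) (a ord0); last first.
  rewrite mul0n big1 // => s _; apply/eqP; rewrite eqb0; apply/forallPn.
  by exists ord0; rewrite lift_perm_id.
rewrite mul1n /T -(IH _ (b \o lift j)) => [|v|i] //=.
  apply: eq_bigr => s _; congr nat_of_bool; apply/forallP/forallP => H i.
    by have := H (lift ord0 i); rewrite lift_perm_lift.
  case: (unliftP ord0 i) => [k|] ->; first by rewrite lift_perm_lift H.
  by rewrite lift_perm_id bj.
have := ab v; rewrite (bigD1_ord ord0) // [RHS](bigD1_ord j) //= bj.
exact: addnI.
Qed.

End CountPermutations.

Section Symmetrization.
Variables (F : fieldType) (n : nat) (al : F).
Hypothesis charF0 : [pchar F] =i pred0.
Hypothesis alP : jack_param al.
Local Notation N := n.+1.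
Local Notation one := (fun _ : 'I_N => 1 : F).
Implicit Types (f g : {mpoly F[N]}) (i j : 'I_N) (s : 'S_N) (m : 'X_{1..N}).

Definition sym_sum f := \sum_(s : 'S_N) msym s f.

Lemma msym_sym_sum s f : msym s (sym_sum f) = sym_sum f.
Proof.
rewrite /sym_sum msym_sum [RHS](reindex_inj (mulIg s)) /=.
by apply: eq_bigr => t _; rewrite msymMm.
Qed.

HB.instance Definition _ := GRing.isLinear.Build F _ _ _ (@cherednik2 F N al)
  (fun c f g => cherednik2_lin al c f g).

Lemma cherednik2_sym_sum f : cherednik2 al (sym_sum f) = sym_sum (cherednik2 al f).
Proof. by rewrite raddf_sum /=; apply: eq_bigr => s _; rewrite cherednik2_msym. Qed.

Lemma excess_seq c m : excess c m = (\sum_(x <- m) (x - c))%N.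
Proof. by rewrite /excess big_tuple; apply: eq_bigr => i _; rewrite mnm_tnth. Qed.

Lemma sum_spectrum_sqr (la : seq nat) m : sorted geq la -> perm_eq m la ->
  \sum_i spectrum al m i ^+ 2 = \sum_(r < N) (al * (nth 0%N la r)%:R - r%:R) ^+ 2.
Proof.
move=> sla mla; rewrite [RHS](reindex_inj (@rank_ord_inj n m)) /=.
by apply: eq_bigr => i _; rewrite /spectrum nth_rank.
Qed.

(* g is the symmetrization of the nonsymmetric Jack polynomial of increasing index,
   the only rearrangement of la occurring in that polynomial. *)
Lemma sym_jack_exists (la : seq nat) : sorted geq la -> size la = N ->
  exists g, [/\ forall s, msym s g = g,
    cherednik2 al g = (\sum_(r < N) (al * (nth 0%N la r)%:R - r%:R) ^+ 2) *: g,
    forall m, perm_eq m la -> g@_m = 1,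
    forall m, g@_m != 0 -> perm_eq m la \/
      mdeg m = sumn la /\ forall c, (excess c m <= \sum_(x <- la) (x - c))%N &
    hook al la * g.@[one] = boxprod la (fun i j : nat => N%:R + (al * j%:R - i%:R))].
Proof.
move=> sla szla; pose B := sumn la.
have laB : all (fun x => x <= B)%N la.
  rewrite /B; elim: (la) => //= x s IH; rewrite leq_addr /=.
  by apply: sub_all IH => y; move=> ys; rewrite (leq_trans ys) ?leq_addl.
have [v [[f [Ef fm fv]] vE]] := nonsym_value_increasing charF0 alP sla szla laB.
set eta := mnm_of n (rev la) in Ef fm.
have etaE : eta = rev la :> seq nat by rewrite val_mnm_of ?size_rev.
have eta_la : perm_eq eta la by rewrite etaE perm_rev.
have eta_sorted : sorted leq eta by rewrite etaE rev_sorted.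
have fsupp m : f@_m != 0 -> m = eta \/ forall c, lower c m eta.
  rewrite -mcoeff_msupp => mf.
  have [->|mN] := eqVneq m eta; first by left.
  right=> c; have := joint_eigen_supp charF0 alP c Ef mf.
  by rewrite (negPf mN).
(* Another rearrangement of la in the support would have smaller [weightQ] than the increasing one,
   which has the least. *)
have fperm m : perm_eq m la -> f@_m = (m == eta)%:R.
  move=> mla; have [->|mN] := eqVneq m eta; first by rewrite fm.
  apply/eqP; apply: contraT => /fsupp[E|/(_ 0%N)/and3P[Q _ _]].
    by rewrite E eqxx in mN.
  have : perm_eq m eta by rewrite perm_sym (perm_trans eta_la) // perm_sym.
  by move/(weightQ_sorted_min eta_sorted); rewrite leqNgt Q.
have stab_gt0 : (0 < stab_order B.+1 la)%N by rewrite prodn_gt0 // => i; apply: fact_gt0.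
have st0 : (stab_order B.+1 la)%:R != 0 :> F by apply: natr_neq0.
have sum_coef m : (sym_sum f)@_m = \sum_(s : 'S_N) f@_(permute m s).
  by rewrite raddf_sum /=; apply: eq_bigr => s _; rewrite mcoeff_sym.
(* Each rearrangement of la arises from [stab_order] permutations, hence the normalization. *)
exists ((stab_order B.+1 la)%:R^-1 *: sym_sum f); split.
- by move=> s; rewrite msymZ msym_sym_sum.
- rewrite linearZ /= cherednik2_sym_sum (cherednik2_joint_eigen Ef) (sum_spectrum_sqr sla eta_la).
  rewrite scalerA mulrC -scalerA; congr (_ *: _); rewrite /sym_sum scaler_sumr.
  by apply: eq_bigr => s _; rewrite msymZ.
- move=> m mla; rewrite mcoeffZ sum_coef; apply: (mulfI st0); rewrite mulVKf // mulr1.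
  rewrite (eq_bigr (fun s => [forall i, m (s i) == eta i]%:R)) => [|s _].
    rewrite -natr_sum (@card_perm_coloring B.+1).
    + congr _%:R; rewrite /stab_order; apply: eq_bigr => w _.
      by rewrite -(seq.permP eta_la) count_mnm.
    + move=> w; rewrite -(count_mnm eta (pred1 w)) -(count_mnm m (pred1 w)); apply/seq.permP.
      by rewrite (perm_trans eta_la) // perm_sym.
    + move=> i; rewrite ltnS; have /allP := laB; apply; rewrite -(perm_mem eta_la).
      by rewrite mnm_tnth mem_tnth.
  rewrite fperm; last exact: perm_trans (perm_permute _ _) mla.
  congr (nat_of_bool _)%:R; apply/eqP/forallP => [E i|E].
    by rewrite -E mnmE.
  by apply/mnmP => i; rewrite mnmE; apply/eqP.
- move=> m; rewrite mcoeffZ sum_coef mulf_eq0 negb_or => /andP[_].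
  have [s fs|f0] := pickP (fun s : 'S_N => f@_(permute m s) != 0); last first.
    by rewrite big1 ?eqxx // => s _; apply/eqP; have := f0 s => /negbFE.
  move=> _; have pm := perm_permute m s; case: (fsupp _ fs) => [E|H].
    by left; rewrite -E perm_sym in eta_la; rewrite (perm_trans _ (eqbLR (perm_sym _ _) eta_la)) // perm_sym.
  right; split.
    have /and3P[_ _ /eqP E] := H 0%N; rewrite mdeg_mperm in E.
    by rewrite E /mdeg (perm_big _ eta_la) sumnE.
  move=> c; have /and3P[_ E _] := H c.
  move: E; rewrite !excess_seq (perm_big _ pm) /= => E; apply: leq_trans E _.
  by rewrite (perm_big _ eta_la).
- rewrite mevalZ /sym_sum raddf_sum /= (eq_bigr (fun=> v)); last first.
    by move=> s _; rewrite meval1_msym.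
  rewrite sumr_const card_Sn -[v *+ _]mulr_natr; apply: (mulfI st0); rewrite -vE.
  by move: (N`!%:R) => Nf; rewrite mulrCA mulVKf // mulrA [hook _ _ * v]mulrC.
Qed.

End Symmetrization.

(** * Self-adjointness *)

Section PowerSums.
Variables (F : fieldType) (N : nat) (al : F).
Hypothesis charF0 : [pchar F] =i pred0.
Implicit Types (h : {mpoly F[N]}) (i j : 'I_N).

Local Notation xi := (cherednik al).

Definition power_sum a : {mpoly F[N]} := \sum_(i < N) 'X_i ^+ a.

Local Notation pw := power_sum.

Lemma sum_ltn_ord m d : (d <= m)%N -> (\sum_(k < m) (k < d) = d)%N.
Proof.
move=> dm; rewrite (eq_bigr (fun k : 'I_m => if (k < d)%N then 1 else 0)%N); last first.
  by move=> k _; case: ltnP.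
rewrite -(big_mkord xpredT (fun k => if (k < d)%N then 1 else 0)%N) -big_mkcond.
by rewrite -(big_nat_widen _ _ _ xpredT) // sum_nat_const_nat subn0 muln1.
Qed.

Lemma tau_mul_sym i j f h : (forall s, msym s h = h) ->
  tau i j (f * h) = tau i j f * h.
Proof.
by move=> hs; rewrite /tau [f * h]mulrC divdiff_mul_sym //; ring.
Qed.

Lemma divdiff_Xn i j a : i != j ->
  ('X_i - 'X_j) * divdiff i j ('X_i ^+ a) = 'X_i ^+ a - 'X_j ^+ a :> {mpoly F[N]}.
Proof.
by move=> ij; rewrite divdiffP !rmorphXn /= msymXU tpermL.
Qed.

Lemma mpoly_addrr_inj : injective (fun h => h + h).
Proof.
move=> h1 h2 /= E; have two : (2%:R : F) != 0 by rewrite ((pcharf0P F).1 charF0).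
apply: (scalerI two); by rewrite !scaler_nat !mulr2n.
Qed.

(** The quotient x_i x_j (x_i^k - x_j^k) / (x_i - x_j), written as a sum so that it also makes sense
    for i = j, where it is k x_i^(k+1). *)
Definition pair_term k i j : {mpoly F[N]} :=
  'X_i * 'X_j * \sum_(b < k) 'X_i ^+ (k.-1 - b) * 'X_j ^+ b.

Lemma pair_termP k i j : ('X_i - 'X_j) * pair_term k i j =
  'X_i * 'X_j * ('X_i ^+ k - 'X_j ^+ k).
Proof. by rewrite /pair_term mulrCA -subrXX. Qed.

Lemma sum_pair_term k : \sum_i \sum_j pair_term k i j =
  \sum_(b < k) pw (k - b) * pw b.+1.
Proof.
rewrite (eq_bigr (fun i => \sum_(b < k) 'X_i ^+ (k - b) * pw b.+1)) => [|i _].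
  by rewrite exchange_big /=; apply: eq_bigr => b _; rewrite -mulr_suml.
rewrite /pair_term (eq_bigr (fun j => \sum_(b < k) 'X_i ^+ (k - b) * 'X_j ^+ b.+1)).
  by rewrite exchange_big /=; apply: eq_bigr => b _; rewrite -mulr_sumr.
move=> j _; rewrite mulr_sumr; apply: eq_bigr => b _.
have bk := ltn_ord b; rewrite mulrACA -!exprS; congr ('X_i ^+ _ * _); lia.
Qed.

(** The summand is not symmetric, but its values at (i, j) and (j, i) add up to those of [pair_term]
    for i != j; hence the doubling of both sides, cancelled in characteristic 0. The diagonal of
    [pair_term], absent on the left, accounts for -k p_(k+1). *)
Lemma sum_tau_Xn k :
  \sum_i \sum_j (tau i j ('X_i ^+ k.+1) - (j < i)%N%:R * 'X_i ^+ k.+1) =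
  \sum_(b < k) pw (k - b) * pw b.+1 - k%:R * pw k.+1.
Proof.
rewrite -sum_pair_term.
transitivity (\sum_i \sum_j (if i == j then 0 else pair_term k i j)); last first.
  rewrite /power_sum mulr_sumr -sumrB; apply: eq_bigr => i _.
  rewrite [in RHS](bigD1 i) //= (bigD1 i) //= eqxx add0r addrAC [X in X + _](_ : _ = 0) ?add0r.
    by apply: eq_bigr => j; rewrite eq_sym => /negPf ->.
  rewrite /pair_term (eq_bigr (fun=> 'X_i ^+ k.-1)); last first.
    by move=> b _; rewrite -exprD; congr ('X_i ^+ _); have := ltn_ord b; lia.
  rewrite sumr_const card_ord; case: k => [|k]; first by rewrite mul0r mulr0n mulr0 subrr.
  by rewrite -mulr_natl /= !exprS; ring.
apply: mpoly_addrr_inj => /=.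
rewrite [X in X + _]exchange_big [X in _ = X + _]exchange_big -!big_split /=.
apply: eq_bigr => i _; rewrite -!big_split /=; apply: eq_bigr => j _.
have [->|ij] := eqVneq i j; first by rewrite !tauii ltnn mul0r subrr.
wlog lij : i j ij / (i < j)%N => [H|].
  have ji : j != i by rewrite eq_sym.
  case: (ltngtP i j) (H i j ij) (H j i ji) => [_ H' _|_ _ H'|/val_inj E _ _].
  - exact: H'.
  - by rewrite addrC [RHS]addrC; apply: H'.
  - by rewrite E eqxx in ij.
have ji : j != i by rewrite eq_sym.
rewrite lij ltnNge (ltnW lij) /= /tau lij ltnNge (ltnW lij) /=.
have P1 := pair_termP k i j.
have P2 : ('X_i - 'X_j) * pair_term k j i = 'X_i * 'X_j * ('X_i ^+ k - 'X_j ^+ k).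
  by rewrite -opprB mulNr pair_termP; ring.
move: P1 P2 (divdiff_Xn k.+1 ij) (divdiff_Xn k.+1 ji).
move: (pair_term k i j) (pair_term k j i) (divdiff i j _) (divdiff j i _) => p1 p2 D1 D2 P1 P2 E1 E2.
apply: (mulfI (mpolyXB_neq0 F ij)); rewrite [RHS]mulrDr P1 P2.
transitivity ('X_j * (('X_i - 'X_j) * D1) - 'X_j * (('X_j - 'X_i) * D2)
  - 2%:R * ('X_i - 'X_j) * 'X_j ^+ k.+1); first by ring.
by rewrite E1 E2 !exprS; ring.
Qed.

Lemma mderiv_Xn i a : ('X_i ^+ a)^`M(i) * 'X_i = a%:R * 'X_i ^+ a :> {mpoly F[N]}.
Proof.
elim: a => [|a IH]; first by rewrite expr0 -mpolyC1 mderivC !mul0r.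
rewrite exprS mderivM mderivX mnm1E eqxx scale1r.
rewrite (_ : (U_(i) - U_(i))%MM = 0%MM); last first.
  by apply/mnmP => j; rewrite mnmBE subnn mnmE.
by rewrite mpolyX0 mul1r mulrDl -mulrA IH -natr1; ring.
Qed.

Lemma cherednik_Xn_sym i a h : (forall s, msym s h = h) ->
  xi i ('X_i ^+ a * h) = (al * a%:R) *: ('X_i ^+ a * h)
    + al *: ('X_i ^+ a * ('X_i * h^`M(i))) + (\sum_j tau i j ('X_i ^+ a)) * h.
Proof.
move=> hs; rewrite cherednikE mderivM [X in _ = _ + X]mulr_suml.
rewrite (eq_bigr (fun j => tau i j ('X_i ^+ a) * h)) => [|j _]; last exact: tau_mul_sym.
congr (_ + _); rewrite -scalerA -scalerDr; congr (_ *: _).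
transitivity (('X_i ^+ a)^`M(i) * 'X_i * h + 'X_i ^+ a * ('X_i * h^`M(i))); first by ring.
rewrite mderiv_Xn -mul_mpolyC mpolyC_nat; ring.
Qed.

(** Divided differences of a symmetric polynomial vanish, which leaves -h for each j < i. *)
Lemma cherednik_sym i h : (forall s, msym s h = h) ->
  xi i h = al *: ('X_i * h^`M(i)) - i%:R * h.
Proof.
move=> hs; rewrite cherednikE; congr (_ + _).
rewrite (eq_bigr (fun j : 'I_N => - ((j < i)%N%:R * h))) => [|j _].
  by rewrite sumrN -mulr_suml -natr_sum sum_ltn_ord // ltnW.
have [->|ij] := eqVneq i j; first by rewrite tauii ltnn mul0r oppr0.
by rewrite /tau (divdiffE (g := 0)) ?mulr0 ?sub0r // hs subrr.
Qed.

Variable n : nat.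
Implicit Types (f : {mpoly F[n]}) (k : 'I_n).

(* 'X_k stands for the power sum p_(k+1). *)
Definition psym_eval f : {mpoly F[N]} := f \mPo [tuple pw k.+1 | k < n].

Local Notation Psi := psym_eval.

Lemma PsiP c f g : Psi (c *: f + g) = c *: Psi f + Psi g.
Proof. by rewrite /psym_eval linearP. Qed.

Lemma PsiM f g : Psi (f * g) = Psi f * Psi g.
Proof. by rewrite /psym_eval rmorphM. Qed.

Lemma Psi1 : Psi 1 = 1.
Proof. by rewrite /psym_eval rmorph1. Qed.

Lemma Psi0 : Psi 0 = 0.
Proof. by rewrite /psym_eval raddf0. Qed.

Lemma PsiD f g : Psi (f + g) = Psi f + Psi g.
Proof. by rewrite -[f in LHS]scale1r PsiP scale1r. Qed.

Lemma PsiX k : Psi 'X_k = pw k.+1.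
Proof. by rewrite /psym_eval comp_mpolyXU -tnth_nth tnth_mktuple. Qed.

Lemma mpoly_gen_ind (R : {mpoly F[n]} -> Prop) :
  R 1 -> (forall c f g, R f -> R g -> R (c *: f + g)) ->
  (forall k f, R f -> R ('X_k * f)) -> forall f, R f.
Proof.
move=> R1 Rl RX.
have R0 : R 0 by have := Rl (-1) 1 1 R1 R1; rewrite scaleN1r addNr.
have Rm m : R 'X_[m].
  have [d] := ubnP (mdeg m); elim: d m => // d IH m dm.
  have [|mN0] := boolP (mdeg m == 0%N).
    by rewrite mdeg_eq0 => /eqP ->; rewrite mpolyX0.
  have /existsP[k mk] : [exists k, m k != 0%N].
    rewrite -negb_forall; apply: contra mN0 => /forallP m0.
    by rewrite mdegE big1 // => k _; apply/eqP.
  have [m' mE] : exists m', m = (U_(k) + m')%MM.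
    by exists (m - U_(k))%MM; rewrite addmC submK // lep1mP.
  rewrite mE mpolyXD; apply: RX; apply: IH.
  by move: dm; rewrite mE mdegD mdeg1.
by elim/mpolyind => // c m f _ _ Rf; apply: Rl.
Qed.

Lemma Psi_sym f s : msym s (Psi f) = Psi f.
Proof.
elim/mpoly_gen_ind: f => [|c f g Ef Eg|k f Ef].
- by rewrite Psi1 msym1.
- by rewrite PsiP msymD msymZ Ef Eg.
- rewrite PsiM msymM Ef PsiX /power_sum msym_sum; congr (_ * _).
  rewrite [RHS](reindex_inj (@perm_inj _ s)) /=; apply: eq_bigr => i _.
  by rewrite rmorphXn /= msymXU.
Qed.

(** The chain rule: x_i d/dx_i sends p_(k+1) to (k+1) x_i^(k+1). *)
Lemma mderiv_Psi f i :
  'X_i * (Psi f)^`M(i) = \sum_(k < n) k.+1%:R * 'X_i ^+ k.+1 * Psi f^`M(k).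
Proof.
elim/mpoly_gen_ind: f => [|c f g Ef Eg|l f Ef].
- rewrite Psi1 -mpolyC1 mderivC mulr0 big1 // => k _.
  by rewrite -mpolyC1 mderivC Psi0 mulr0.
- rewrite PsiP mderivD mderivZ mulrDr -scalerAr Ef Eg scaler_sumr -big_split /=.
  by apply: eq_bigr => k _; rewrite mderivD mderivZ PsiP mulrDr -scalerAr.
- rewrite PsiM PsiX mderivM mulrDr ['X_i * (pw _ * _)]mulrCA Ef.
  have -> : 'X_i * ((pw l.+1)^`M(i) * Psi f) = l.+1%:R * 'X_i ^+ l.+1 * Psi f.
    rewrite /power_sum raddf_sum /= mulrA; congr (_ * _).
    rewrite (bigD1 i) //= big1 ?addr0 => [|j ji]; first by rewrite mulrC mderiv_Xn.
    have Xj : ('X_j : {mpoly F[N]})^`M(i) = 0.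
      by rewrite mderivX mnm1E (negPf ji) scale0r.
    by elim: (l.+1) => [|a IH]; rewrite ?expr0 -?mpolyC1 ?mderivC // exprS mderivM Xj IH mul0r mulr0 addr0.
  have S : \sum_(k < n | k != l) k.+1%:R * 'X_i ^+ k.+1 * Psi ('X_l * f)^`M(k) =
      pw l.+1 * \sum_(k < n | k != l) k.+1%:R * 'X_i ^+ k.+1 * Psi f^`M(k).
    rewrite [RHS]mulr_sumr; apply: eq_bigr => k kl.
    rewrite mderivM mderivX mnm1E eq_sym (negPf kl) scale0r mul0r add0r.
    by rewrite PsiM PsiX; ring.
  rewrite (bigD1 l) //= [in RHS](bigD1 l) //= S.
  rewrite mderivM mderivX mnm1E eqxx scale1r.
  rewrite (_ : (U_(l) - U_(l))%MM = 0%MM); last first.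
    by apply/mnmP => j; rewrite mnmBE subnn mnmE.
  by rewrite mpolyX0 mul1r PsiD PsiM PsiX; ring.
Qed.

Lemma cherednik2_Psi f : cherednik2 al (Psi f) =
  \sum_(k < n) (al * k.+1%:R) *: (((al * k.+1%:R) *: pw k.+1 - k%:R * pw k.+1
      + \sum_(b < k) pw (k - b) * pw b.+1) * Psi f^`M(k))
  + (al ^+ 2) *: (\sum_(k < n) \sum_(l < n) (k.+1 * l.+1)%:R * pw (k.+1 + l.+1) * Psi f^`M(k)^`M(l))
  + (\sum_(i < N) i ^ 2)%N%:R * Psi f.
Proof.
have cherednik_Psi i g : xi i (Psi g) =
    \sum_(k < n) (al * k.+1%:R) *: ('X_i ^+ k.+1 * Psi g^`M(k)) - i%:R * Psi g.
  rewrite cherednik_sym; last exact: Psi_sym.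
  rewrite mderiv_Psi scaler_sumr; congr (_ - _); apply: eq_bigr => k _.
  by rewrite -mulrA -scalerA; congr (_ *: _); rewrite mulr_natl scaler_nat.
(* The first application gives terms x_i^(k+1) times a symmetric polynomial, and -i times [Psi f].
   The x_i^(k+1) terms that the latter yields at the second application are spread over the j < i,
   which gives the shape of [sum_tau_Xn]. *)
have cherednik_i i : xi i (xi i (Psi f)) = \sum_(k < n) (al * k.+1%:R) *:
    (((al * k.+1%:R) *: 'X_i ^+ k.+1 + \sum_j (tau i j ('X_i ^+ k.+1) - (j < i)%N%:R * 'X_i ^+ k.+1))
       * Psi f^`M(k))
    + (al ^+ 2) *: (\sum_(k < n) \sum_(l < n) (k.+1 * l.+1)%:R * 'X_i ^+ (k.+1 + l.+1) * Psi f^`M(k)^`M(l))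
    + (i ^ 2)%N%:R * Psi f.
  rewrite [in LHS]cherednik_Psi raddfB raddf_sum /= mulr_natl raddfMn /= cherednik_Psi.
  rewrite -[_ *+ i]mulr_natl mulrBr opprB addrCA addrC.
  rewrite mulrA -natrM mulnn; congr (_ + _).
  rewrite mulr_sumr scaler_sumr -sumrB -big_split /=; apply: eq_bigr => k _.
  rewrite cherednikZ cherednik_Xn_sym; last exact: Psi_sym.
  have -> : \sum_j (tau i j ('X_i ^+ k.+1) - (j < i)%N%:R * 'X_i ^+ k.+1) =
      \sum_j tau i j ('X_i ^+ k.+1) - i%:R * 'X_i ^+ k.+1 :> {mpoly F[N]}.
    by rewrite sumrB -mulr_suml -natr_sum sum_ltn_ord // ltnW.
  rewrite mderiv_Psi.
  set S := (\sum_(l < n) _ : {mpoly F[N]}); set S' := (\sum_(l < n) _ : {mpoly F[N]}).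
  have -> : S' = k.+1%:R * 'X_i ^+ k.+1 * S.
    rewrite /S' /S [RHS]mulr_sumr; apply: eq_bigr => l _.
    by rewrite natrM exprD; ring.
  rewrite -!mul_mpolyC !mpolyCM mpolyC_nat; ring.
rewrite /cherednik2 (eq_bigr _ (fun i _ => cherednik_i i)) !big_split /=; congr (_ + _ + _).
- rewrite exchange_big; apply: eq_bigr => k _ /=; rewrite -scaler_sumr -mulr_suml.
  congr (_ *: (_ * _)); rewrite big_split /= -scaler_sumr sum_tau_Xn.
  by rewrite addrA addrAC.
- rewrite -scaler_sumr exchange_big /=; congr (_ *: _); apply: eq_bigr => k _.
  rewrite exchange_big; apply: eq_bigr => l _ /=.
  by rewrite -mulr_suml -mulr_sumr.
- by rewrite -mulr_suml -natr_sum.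
Qed.

End PowerSums.

(** * The Laplace-Beltrami operator on polynomials in the power sums *)

Section SelfAdjoint.
Variables (F : fieldType) (n : nat) (al : F).
Implicit Types (f g : {mpoly F[n]}) (k b c : 'I_n) (m : 'X_{1..n}).

(** When m lists the multiplicities of mu this is al^l(mu) z_mu, so [pdot] is the scalar product of
    the Jack functions carried over to F[p_1, ..., p_n]. *)
Definition pdot_weight m : F := \prod_(k < n) ((al * k.+1%:R) ^+ m k * (m k)`!%:R).

Definition pdot f g : F := \sum_(m <- msupp f) f@_m * g@_m * pdot_weight m.

Lemma pdotE f g (r : seq 'X_{1..n}) : uniq r -> {subset msupp f <= r} ->
  pdot f g = \sum_(m <- r) f@_m * g@_m * pdot_weight m.
Proof.
move=> ur fr; rewrite [RHS](bigID (mem (msupp f))) /= [X in _ + X]big1 ?addr0; last first.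
  by move=> m /memN_msupp_eq0 ->; rewrite !mul0r.
rewrite -big_filter; apply: perm_big; apply: uniq_perm; rewrite ?filter_uniq ?msupp_uniq //.
by move=> m; rewrite mem_filter /= andb_idr // => /fr.
Qed.

Lemma pdotC f g : pdot f g = pdot g f.
Proof.
rewrite !(@pdotE _ _ (undup (msupp f ++ msupp g))) ?undup_uniq //; last first.
- by move=> m mf; rewrite mem_undup mem_cat mf.
- by move=> m mf; rewrite mem_undup mem_cat mf orbT.
by apply: eq_bigr => m _; congr (_ * _); rewrite mulrC.
Qed.

Lemma pdotPr (a : F) f g h : pdot f (a *: g + h) = a * pdot f g + pdot f h.
Proof.
rewrite /pdot mulr_sumr -big_split /=; apply: eq_bigr => m _.
by rewrite mcoeffD mcoeffZ; ring.
Qed.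

HB.instance Definition _ f := GRing.isLinear.Build F _ F^o _ (pdot f) (fun a => pdotPr a f).

Lemma pdotZr (a : F) f g : pdot f (a *: g) = a * pdot f g.
Proof. exact: linearZ. Qed.

Lemma pdotZl (a : F) f g : pdot (a *: f) g = a * pdot f g.
Proof. by rewrite pdotC pdotZr pdotC. Qed.

Lemma pdotDr f g h : pdot f (g + h) = pdot f g + pdot f h.
Proof. exact: raddfD. Qed.

Lemma pdotDl f g h : pdot (f + g) h = pdot f h + pdot g h.
Proof. by rewrite pdotC pdotDr !(pdotC h). Qed.

Lemma pdot_sumr (I : Type) (r : seq I) (P : pred I) f (G : I -> {mpoly F[n]}) :
  pdot f (\sum_(i <- r | P i) G i) = \sum_(i <- r | P i) pdot f (G i).
Proof. exact: raddf_sum. Qed.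

Lemma pdot_suml (I : Type) (r : seq I) (P : pred I) f (G : I -> {mpoly F[n]}) :
  pdot (\sum_(i <- r | P i) G i) f = \sum_(i <- r | P i) pdot (G i) f.
Proof. by rewrite pdotC pdot_sumr; apply: eq_bigr => i _; rewrite pdotC. Qed.

Lemma pdotX m g : pdot 'X_[m] g = g@_m * pdot_weight m.
Proof. by rewrite /pdot msuppX big_seq1 mcoeffX eqxx mul1r. Qed.

(** Raising the exponent of p_(k+1) by one multiplies the weight by al (k+1) times the new exponent,
    and that exponent is the factor produced by differentiation. *)
Lemma pdot_mulXl k f g : pdot ('X_k * f) g = al * k.+1%:R * pdot f g^`M(k).
Proof.
elim/mpolyind: f => [|c m f _ _ IH].
  by rewrite mulr0 /pdot msupp0 !big_nil mulr0.
rewrite mulrDr -scalerAr !pdotDl !pdotZl IH -mpolyXD !pdotX mcoeff_deriv.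
rewrite [LHS]addrC [RHS]mulrDr [RHS]addrC; congr (_ + _).
have -> : pdot_weight (U_(k) + m)%MM = al * k.+1%:R * (m k).+1%:R * pdot_weight m.
  rewrite /pdot_weight (bigD1 k) //= [in RHS](bigD1 k) //= !mulrA mnmDE mnm1E eqxx.
  congr (_ * _); first by rewrite add1n factS natrM exprS; ring.
  by apply: eq_bigr => l lk; rewrite mnmDE mnm1E eq_sym (negPf lk).
by rewrite addmC -mulr_natr; ring.
Qed.

Lemma pdot_mulXr k f g : pdot f ('X_k * g) = al * k.+1%:R * pdot f^`M(k) g.
Proof. by rewrite pdotC pdot_mulXl pdotC. Qed.

(* Both are 0 when n <= a. *)
Definition var_at a : {mpoly F[n]} := \sum_(k < n | k == a :> nat) 'X_k.
Definition deriv_at a f : {mpoly F[n]} := \sum_(k < n | k == a :> nat) f^`M(k).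

Lemma pdot_mul_var_at a f g : pdot (var_at a * f) g = al * a.+1%:R * pdot f (deriv_at a g).
Proof.
rewrite /var_at /deriv_at mulr_suml pdot_suml pdot_sumr mulr_sumr.
by apply: eq_bigr => k /eqP <-; rewrite pdot_mulXl.
Qed.

(** Variable [(b + c).+1] is the power sum of index b.+1 + c.+1, here split in two; [join] is the
    reverse operation. *)
Definition cut f : {mpoly F[n]} :=
  \sum_(b < n) \sum_(c < n) (b.+1 + c.+1)%:R *: ('X_b * 'X_c * deriv_at (b + c).+1 f).

Definition join f : {mpoly F[n]} :=
  \sum_(b < n) \sum_(c < n) (b.+1 * c.+1)%:R *: (var_at (b + c).+1 * f^`M(b)^`M(c)).

Lemma pdot_cut f g : pdot (cut f) g = al * pdot f (join g).
Proof.
rewrite /cut /join pdot_suml pdot_sumr mulr_sumr; apply: eq_bigr => b _.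
rewrite pdot_suml pdot_sumr mulr_sumr; apply: eq_bigr => c _.
rewrite pdotZl pdotZr -mulrA !pdot_mulXl [pdot f _]pdotC pdot_mul_var_at [pdot _ (deriv_at _ f)]pdotC.
by rewrite natrM addSn addnS; ring.
Qed.

(** By [pdot_cut] the adjoint of [cut] is al times [join], so the coefficients al and al^2 make the
    last two terms adjoint to each other. *)
Definition laplace_beltrami f : {mpoly F[n]} :=
  \sum_(k < n) (al * k.+1%:R * (al * k.+1%:R - k%:R)) *: ('X_k * f^`M(k))
  + al *: cut f + (al ^+ 2) *: join f.

Lemma pdot_laplace_beltrami f g : pdot (laplace_beltrami f) g = pdot f (laplace_beltrami g).
Proof.
rewrite /laplace_beltrami !pdotDl !pdotDr !pdotZl !pdotZr pdot_cut [pdot (join f) g]pdotC.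
rewrite -addrA [X in _ + X]addrC addrA; congr (_ + _ + _).
- rewrite pdot_suml pdot_sumr; apply: eq_bigr => k _.
  by rewrite pdotZl pdotZr pdot_mulXl pdot_mulXr.
- by rewrite expr2 -mulrA -pdot_cut pdotC.
- by rewrite expr2 mulrA.
Qed.

(** Homogeneity of weight t - s, X_k having weight k.+1, written additively so that derivatives need
    no truncated subtraction. *)
Definition weighted s t f := forall m, f@_m != 0 -> (mnmwgt m + s = t)%N.

Lemma weighted0 s t : weighted s t 0.
Proof. by move=> m; rewrite mcoeff0 eqxx. Qed.

Lemma weightedZ s t a f : weighted s t f -> weighted s t (a *: f).
Proof. by move=> W m; rewrite mcoeffZ mulf_eq0 negb_or => /andP[_ /W]. Qed.

Lemma weightedD s t f g : weighted s t f -> weighted s t g -> weighted s t (f + g).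
Proof.
move=> Wf Wg m; rewrite mcoeffD; have [->|/Wf //] := eqVneq f@_m 0.
by rewrite add0r => /Wg.
Qed.

Lemma weighted_sum s t (I : Type) (r : seq I) (P : pred I) (G : I -> {mpoly F[n]}) :
  (forall i, P i -> weighted s t (G i)) -> weighted s t (\sum_(i <- r | P i) G i).
Proof.
move=> W; apply: big_ind => //; [exact: weighted0 | exact: weightedD].
Qed.

Lemma weighted_deriv s t k f : weighted s t f -> weighted (k.+1 + s) t f^`M(k).
Proof.
move=> W m; rewrite mcoeff_deriv -mulr_natr mulf_eq0 negb_or => /andP[/W + _].
by rewrite mnmwgtD mnmwgt1 addnA.
Qed.

Lemma weighted_mulX s t k f : weighted s t f -> weighted s (k.+1 + t) ('X_k * f).
Proof.
move=> W m; rewrite -mcoeff_msupp mulrC (perm_mem (msuppMX _ _)) => /mapP[m' m'f ->].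
by rewrite mnmwgtD mnmwgt1 -addnA; congr (_ + _)%N; apply: W; rewrite -mcoeff_msupp.
Qed.

Lemma weighted_shift s t u f : weighted (u + s) (u + t) f -> weighted s t f.
Proof. by move=> W m /W; lia. Qed.

Lemma weighted_laplace_beltrami f : weighted 0 n f -> weighted 0 n (laplace_beltrami f).
Proof.
move=> W; apply: weightedD; first apply: weightedD.
- apply: weighted_sum => k _; apply: weightedZ; apply: (@weighted_shift _ _ k.+1).
  exact/weighted_mulX/weighted_deriv.
- apply: weightedZ; apply: weighted_sum => b _; apply: weighted_sum => c _.
  apply: weightedZ; rewrite /deriv_at mulr_sumr; apply: weighted_sum => k /eqP E.
  apply: (@weighted_shift _ _ k.+1).
  have -> : (k.+1 + n = b.+1 + (c.+1 + n))%N by rewrite E; lia.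
  by rewrite -mulrA; apply/weighted_mulX/weighted_mulX/weighted_deriv.
- apply: weightedZ; apply: weighted_sum => b _; apply: weighted_sum => c _.
  apply: weightedZ; rewrite /var_at mulr_suml; apply: weighted_sum => k /eqP E.
  apply: (@weighted_shift _ _ k.+1).
  have -> : (k.+1 + 0 = c.+1 + (b.+1 + 0))%N by rewrite E; lia.
  exact/weighted_mulX/weighted_deriv/weighted_deriv.
Qed.

Variable N : nat.
Hypothesis charF0 : [pchar F] =i pred0.
Local Notation Psi := (@psym_eval F N n).
Local Notation pw := (power_sum F N).

Lemma Psi_sum (I : Type) (r : seq I) (P : pred I) (G : I -> {mpoly F[n]}) :
  Psi (\sum_(i <- r | P i) G i) = \sum_(i <- r | P i) Psi (G i).
Proof. by rewrite /psym_eval raddf_sum. Qed.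

Lemma PsiZ (a : F) f : Psi (a *: f) = a *: Psi f.
Proof. by rewrite /psym_eval linearZ. Qed.

Lemma sum_ord_pick (V : nmodType) (G : nat -> V) a :
  \sum_(c < n | c == a :> nat) G c = if (a < n)%N then G a else 0.
Proof.
case: ltnP => an; last by rewrite big_pred0 // => c; have := ltn_ord c; lia.
by rewrite (big_pred1 (Ordinal an)) // => c.
Qed.

Lemma Psi_var_at a : Psi (var_at a) = if (a < n)%N then pw a.+1 else 0.
Proof.
rewrite /var_at Psi_sum -(sum_ord_pick (fun a => pw a.+1)).
by apply: eq_bigr => k _; rewrite PsiX.
Qed.

Lemma Psi_cut f : Psi (cut f) =
  \sum_(k < n) k.+1%:R *: ((\sum_(b < k) pw (k - b) * pw b.+1) * Psi f^`M(k)).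
Proof.
transitivity (\sum_(b < n) \sum_(c < n) \sum_(k < n | (k : nat) == (b + c).+1)
    k.+1%:R *: (pw b.+1 * pw c.+1 * Psi f^`M(k))).
  rewrite /cut Psi_sum; apply: eq_bigr => b _; rewrite Psi_sum; apply: eq_bigr => c _.
  rewrite PsiZ !PsiM !PsiX /deriv_at Psi_sum mulr_sumr scaler_sumr.
  by apply: eq_bigr => k /eqP ->; rewrite addSn addnS.
under eq_bigr => b _ do rewrite (exchange_big_dep xpredT) //=.
rewrite exchange_big; apply: eq_bigr => k _ /=.
rewrite (big_ord_widen n (fun b : nat => pw (k - b) * pw b.+1)); last exact: ltnW.
rewrite [in RHS]big_mkcond /= mulr_suml scaler_sumr; apply: eq_bigr => b _.
rewrite (eq_bigl (fun c : 'I_n => (b < k)%N && (c == (k - b).-1 :> nat))); last by move=> c; lia.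
case: ltnP => bk; last by rewrite big_pred0 // mul0r scaler0.
rewrite /= (eq_bigr (fun c : 'I_n => k.+1%:R *: (pw b.+1 * pw c.+1 * Psi f^`M(k)))) //.
rewrite (sum_ord_pick (fun c : nat => k.+1%:R *: (pw b.+1 * pw c.+1 * Psi f^`M(k)))).
have := ltn_ord k => kn; rewrite ifT; last by lia.
by congr (_ *: (_ * _)); rewrite mulrC; congr (pw _ * _); lia.
Qed.

(** Weight n makes the truncation harmless: when p_(b+c+2) has index above n, so that [var_at] is 0,
    the second derivative of f vanishes as well. *)
Lemma Psi_join f : weighted 0 n f -> Psi (join f) =
  \sum_(b < n) \sum_(c < n) (b.+1 * c.+1)%:R * pw (b.+1 + c.+1) * Psi f^`M(b)^`M(c).
Proof.
move=> W; rewrite /join Psi_sum; apply: eq_bigr => b _; rewrite Psi_sum.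
apply: eq_bigr => c _; rewrite PsiZ PsiM Psi_var_at scaler_nat -mulrA mulr_natl.
have -> : (b.+1 + c.+1 = (b + c).+2)%N by lia.
congr (_ *+ _); case: ltnP => // nbc; rewrite mul0r.
suff -> : f^`M(b)^`M(c) = 0 by rewrite Psi0 mulr0.
have W2 := weighted_deriv (k := c) (weighted_deriv (k := b) W).
apply/mpolyP => m; rewrite mcoeff0; apply/eqP; apply: contraT => /W2; lia.
Qed.

Lemma cherednik2_laplace_beltrami f : weighted 0 n f ->
  cherednik2 al (Psi f) = Psi (laplace_beltrami f) + (\sum_(i < N) i ^ 2)%N%:R *: Psi f.
Proof.
move=> W; rewrite cherednik2_Psi // scaler_nat mulr_natl; congr (_ + _).
rewrite /laplace_beltrami !PsiD !PsiZ Psi_join // Psi_cut Psi_sum; congr (_ + _).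
rewrite scaler_sumr -big_split /=; apply: eq_bigr => k _.
rewrite PsiZ PsiM PsiX -!mul_mpolyC !mpolyCM mpolyCB mpolyCM !mpolyC_nat; ring.
Qed.

End SelfAdjoint.

(** * Partitions of n as monomials of weight n in the power sums *)

Section PartitionMonomials.
Variables (F : fieldType) (n : nat) (al : F).
Implicit Types (mu la : intpart n) (m : 'X_{1..n}).

Lemma intpart_sorted la : sorted geq la.
Proof. by case/and3P: (intpartP la). Qed.

Lemma intpart_sumn la : sumn la = n.
Proof. by case/and3P: (intpartP la) => _ _ /eqP. Qed.

Lemma intpart_gt0 la x : x \in (la : seq nat) -> (0 < x)%N.
Proof.
by case/and3P: (intpartP la) => _ la0 _ xla; rewrite lt0n; apply: contraNneq la0 => <-.
Qed.

Lemma intpart_le la x : x \in (la : seq nat) -> (x <= n)%N.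
Proof.
rewrite -{2}(intpart_sumn la); elim: (la : seq nat) => //= y s IH.
by rewrite inE => /orP[/eqP ->|/IH]; lia.
Qed.

Lemma intpart_size la : (size la <= n)%N.
Proof.
rewrite -{2}(intpart_sumn la); have := @intpart_gt0 la.
elim: (la : seq nat) => //= y s IH gt0.
have := gt0 y (mem_head _ _); suff /IH : forall x, x \in s -> (0 < x)%N by lia.
by move=> x xs; apply: gt0; rewrite inE xs orbT.
Qed.

Lemma intpart_perm_eq la mu : perm_eq la mu -> la = mu.
Proof.
move=> E; apply: parts_inj; apply: (sorted_eq (leT := geq)) => //.
- by move=> x y z /= yx zy; apply: leq_trans yx.
- by move=> x y /= ?; apply/eqP; rewrite eqn_leq andbC.
- exact: intpart_sorted.
- exact: intpart_sorted.
Qed.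

Definition mono mu : 'X_{1..n} := [multinom count_mem k.+1 (mu : seq nat) | k < n].

Lemma mono_inj : injective mono.
Proof.
move=> la mu E; apply: intpart_perm_eq; apply/allP => x _ /=; apply/eqP.
case: x => [|x].
  have z (nu : intpart n) : count_mem 0%N (nu : seq nat) = 0%N.
    by apply/count_memPn/negP => /intpart_gt0.
  by rewrite !z.
have [xn|nx] := ltnP x n.
  by have /mnmP/(_ (Ordinal xn)) := E; rewrite !mnmE.
have z (nu : intpart n) : count_mem x.+1 (nu : seq nat) = 0%N.
  by apply/count_memPn/negP => /intpart_le; lia.
by rewrite !z.
Qed.

Lemma big_intpart (R : Type) (idx : R) (op : Monoid.com_law idx) (G : nat -> R) mu :
  \big[op/idx]_(x <- mu) G x =
  \big[op/idx]_(k < n) \big[op/idx]_(x <- mu | x == k.+1) G k.+1.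
Proof.
rewrite (exchange_big_dep xpredT) //= !big_seq; apply: eq_bigr => x xmu.
have x0 := intpart_gt0 xmu; have xn := intpart_le xmu.
have xn' : (x.-1 < n)%N by lia.
rewrite (big_pred1 (Ordinal xn')) /= ?prednK // => k.
by rewrite /= -(inj_eq val_inj) /=; lia.
Qed.

Lemma mnmwgt_mono mu : mnmwgt (mono mu) = n.
Proof.
rewrite -[RHS](intpart_sumn mu) sumnE big_intpart; apply: eq_bigr => k _.
by rewrite mnmE big_const_seq iter_addn_0 mulnC.
Qed.

Lemma mono_surj m : mnmwgt m = n -> exists mu, mono mu = m.
Proof.
move=> mn; pose s := flatten [seq nseq (m k) k.+1 | k <- enum 'I_n].
have cs x : count_mem x s = (\sum_(k < n) (k.+1 == x) * m k)%N.
  rewrite count_flatten -map_comp sumnE big_map big_enum /=.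
  by apply: eq_bigr => k _; rewrite /= count_nseq.
have ps : is_part n (sort geq s).
  apply/and3P; split.
  - by apply: sort_sorted => x y /=; apply: leq_total.
  - rewrite mem_sort; apply/count_memPn; rewrite cs big1 // => k _.
  - rewrite (perm_sumn (permEl (perm_sort _ _))) -mn /s sumn_flatten -map_comp.
    rewrite sumnE big_map big_enum /=; apply/eqP; apply: eq_bigr => k _ /=.
    by rewrite sumn_nseq mulnC.
have [mu muE] := intpart_surj ps; exists mu; apply/mnmP => k.
rewrite mnmE muE (seq.permP (permEl (perm_sort _ _))) cs (bigD1 k) //= eqxx mul1n big1 ?addn0 // => l lk.
by rewrite eqSS (inj_eq val_inj) (negPf lk).
Qed.

Definition part_poly (c : intpart n -> F) : {mpoly F[n]} := \sum_mu c mu *: 'X_[mono mu].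

Lemma mcoeff_part_poly c mu : (part_poly c)@_(mono mu) = c mu.
Proof.
rewrite /part_poly raddf_sum /= (bigD1 mu) //= big1 => [|la lamu].
  by rewrite mcoeffZ mcoeffX eqxx mulr1 addr0.
by rewrite mcoeffZ mcoeffX (inj_eq mono_inj) (negPf lamu) mulr0.
Qed.

Lemma weighted_part_poly c : weighted 0 n (part_poly c).
Proof.
apply: weighted_sum => mu _; apply: weightedZ => m; rewrite mcoeffX addn0.
by case: (mono mu =P m) => [<- _|_]; [rewrite mnmwgt_mono | rewrite eqxx].
Qed.

Lemma part_poly_weighted f : weighted 0 n f -> f = part_poly (fun mu => f@_(mono mu)).
Proof.
move=> W; apply/mpolyP => m; have [fm|fm] := eqVneq f@_m 0.
  rewrite fm; apply/esym/eqP; apply: contraT => pm.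
  have := weighted_part_poly pm; rewrite addn0 => /mono_surj[mu E].
  by move: pm; rewrite -E mcoeff_part_poly E fm eqxx.
have := W m fm; rewrite addn0 => /mono_surj[mu <-].
by rewrite mcoeff_part_poly.
Qed.

Lemma pdot_weight_mono mu :
  pdot_weight al (mono mu) = al ^+ size mu * (zpart mu)%:R.
Proof.
rewrite /pdot_weight /zpart intpart_sumn big_add1 big_mkord natr_prod.
have -> : size mu = (\sum_(k < n) count_mem k.+1 (mu : seq nat))%N.
  rewrite -sum1_size (big_intpart _ (fun=> 1)%N); apply: eq_bigr => k _.
  by rewrite sum1_count.
rewrite -prodrXr -big_split /=; apply: eq_bigr => k _.
by rewrite mnmE natrM natrX exprMn mulrA.
Qed.

Lemma jack_dot_pdot c d : jack_dot al c d = pdot al (part_poly c) (part_poly d).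
Proof.
rewrite (@pdotE _ _ _ _ _ [seq mono mu | mu <- enum {: intpart n}]); last 2 first.
- by rewrite map_inj_uniq ?enum_uniq //; apply: mono_inj.
- move=> m; rewrite mcoeff_msupp => /weighted_part_poly; rewrite addn0 => /mono_surj[mu <-].
  by rewrite map_f // mem_enum.
rewrite big_map big_enum /=; apply: eq_bigr => mu _.
by rewrite !mcoeff_part_poly pdot_weight_mono.
Qed.

Variable N : nat.

Lemma Psi_mono mu : psym_eval N 'X_[mono mu] = psym F mu N.
Proof.
rewrite /psym_eval comp_mpolyX /psym (big_intpart _ (fun x => \sum_(i < N) 'X_i ^+ x)).
apply: eq_bigr => k _; rewrite tnth_mktuple mnmE big_const_seq iter_mulr_1.
by [].
Qed.

Lemma Psi_part_poly c : psym_eval N (part_poly c) = \sum_mu c mu *: psym F mu N.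
Proof.
by rewrite /part_poly Psi_sum; apply: eq_bigr => mu _; rewrite PsiZ Psi_mono.
Qed.

Hypothesis charF0 : [pchar F] =i pred0.

(** Independence of the power sums lifts the eigenvalue equations from N variables to
    F[p_1, ..., p_n], where [laplace_beltrami] is self-adjoint. The constant C shifts both
    eigenvalues alike. *)
Lemma eigen_orth (c d : intpart n -> F) (e e' : F) :
  (forall c' : intpart n -> F, \sum_mu c' mu *: psym F mu N = 0 -> forall mu, c' mu = 0) ->
  cherednik2 al (\sum_mu c mu *: psym F mu N) = e *: (\sum_mu c mu *: psym F mu N) ->
  cherednik2 al (\sum_mu d mu *: psym F mu N) = e' *: (\sum_mu d mu *: psym F mu N) ->
  e != e' -> jack_dot al c d = 0.
Proof.
move=> inj Ec Ed ee'; set C : F := (\sum_(i < N) i ^ 2)%N%:R.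
have L (c' : intpart n -> F) (e1 : F) : cherednik2 al (\sum_mu c' mu *: psym F mu N) = e1 *: (\sum_mu c' mu *: psym F mu N) ->
    laplace_beltrami al (part_poly c') = (e1 - C) *: part_poly c'.
  rewrite -Psi_part_poly cherednik2_laplace_beltrami //; last exact: weighted_part_poly.
  move/(canRL (addrK _)); rewrite -scalerBl -/C => E.
  have W := weighted_laplace_beltrami (al := al) (@weighted_part_poly c').
  pose f := laplace_beltrami al (part_poly c') - (e1 - C) *: part_poly c'.
  have Wf : weighted 0 n f.
    rewrite /f -scaleNr; apply: weightedD => //.
    by apply: weightedZ; apply: weighted_part_poly.
  have f0 : f = 0.
    rewrite (part_poly_weighted Wf) /part_poly big1 // => mu _.
    rewrite (inj (fun mu => f@_(mono mu))) ?scale0r // -Psi_part_poly.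
    by rewrite -part_poly_weighted // /f -scaleNr PsiD PsiZ E scaleNr subrr.
  by apply/eqP; rewrite -subr_eq0 -/f f0.
have := pdot_laplace_beltrami al (part_poly c) (part_poly d).
rewrite (L _ _ Ec) (L _ _ Ed) pdotZl pdotZr -jack_dot_pdot => /eqP.
rewrite -subr_eq0 -mulrBl mulf_eq0 => /orP[|/eqP //].
by rewrite opprB addrA subrK subr_eq0 (negPf ee').
Qed.

End PartitionMonomials.

(** * Identification with the Jack functions *)

Section DominanceOrder.
Implicit Types (s : seq nat).

Lemma sumn_take s k : sumn (take k s) = (\sum_(r < k) nth 0 s r)%N.
Proof.
elim: s k => [|x s IH] k; first by rewrite big1 // => i _; rewrite nth_nil.
by case: k => [|k] /=; rewrite ?big_ord0 // big_ord_recl /= IH.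
Qed.

(** For decreasing s the bound is attained at c = nth 0 s k when k is fixed, and at k = #{x > c}
    when c is fixed. Dominance therefore amounts to inequalities between excesses. *)
Lemma sumn_take_le_excess c s k : (sumn (take k s) <= \sum_(x <- s) (x - c) + k * c)%N.
Proof.
elim: s k => [|x s IH] [|k] //=; rewrite big_cons.
by have := IH k; rewrite mulSn; lia.
Qed.

Lemma sorted_geq_le s x : sorted geq (x :: s) -> forall y, y \in s -> (y <= x)%N.
Proof.
move=> ps y ys; have /allP/(_ y ys) := order_path_min (rev_trans leq_trans) ps; exact.
Qed.

Lemma excess_sorted_eq0 c x s : sorted geq (x :: s) -> (x <= c)%N ->
  (\sum_(y <- s) (y - c) = 0)%N.
Proof.
move=> ps xc; rewrite big_seq big1 // => y /(sorted_geq_le ps); lia.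
Qed.

Lemma sumn_take_excess_nth s k : sorted geq s ->
  (\sum_(x <- s) (x - nth 0 s k) + k * nth 0 s k = sumn (take k s))%N.
Proof.
elim: s k => [|x s IH] k ps; first by rewrite big_nil nth_nil muln0.
rewrite big_cons; case: k => [|k] /=.
  by rewrite (excess_sorted_eq0 ps) // subnn.
have := IH k (path_sorted ps); have : (nth 0 s k <= x)%N.
  have [ks|sk] := ltnP k (size s); last by rewrite nth_default.
  by apply: (sorted_geq_le ps); apply: mem_nth.
by rewrite mulSn; lia.
Qed.

Lemma sumn_take_excess_count s c : sorted geq s ->
  (\sum_(x <- s) (x - c) + count (fun x => c < x) s * c =
   sumn (take (count (fun x => c < x) s) s))%N.
Proof.
elim: s => [|x s IH] ps; first by rewrite big_nil.
rewrite big_cons /=; have := IH (path_sorted ps).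
case: (ltnP c x) => cx; first by rewrite add1n /= mulSn; lia.
have z := excess_sorted_eq0 ps cx.
have -> : count (fun x => c < x)%N s = 0%N.
  apply/eqP; rewrite -leqn0 leqNgt -has_count; apply/hasPn => y /(sorted_geq_le ps).
  lia.
by rewrite z add0n take0 /=; lia.
Qed.

Lemma sum_subn x n : (x <= n)%N -> ((\sum_(c < n) (x - c)) * 2 = x ^ 2 + x)%N.
Proof.
elim: n x => [|n IH] x xn.
  have -> : x = 0%N by lia.
  by rewrite big_ord0.
have [E|lt] := leqP x n.
  by rewrite big_ord_recr /= mulnDl IH //; lia.
have -> : x = n.+1 by lia.
rewrite big_ord_recl subn0 mulnDl.
under eq_bigr do rewrite /= /bump subSS.
rewrite IH //; nia.
Qed.

Lemma sum_sumn_take s m :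
  (\sum_(k < m.+1) sumn (take k s) + \sum_(r < m) r * nth 0 s r =
   m * \sum_(r < m) nth 0 s r)%N.
Proof.
elim: m => [|m IH]; first by rewrite big_ord_recl !big_ord0 take0.
by move: IH; rewrite !big_ord_recr /= !sumn_take !big_ord_recr /=; nia.
Qed.

Variables (n : nat).
Implicit Types (mu la ka : intpart n).

(** Strictly increasing for dominance when n <= N, hence the measure of the later inductions; it
    also carries the part of the eigenvalue that is linear in al. *)
Definition prefix_sum N la : nat := (\sum_(k < N.+1) sumn (take k la))%N.

Lemma dominatedP mu la :
  reflect (forall k, sumn (take k mu) <= sumn (take k la))%N (dominated mu la).
Proof.
apply: (iffP forallP) => [H k|H k]; last exact: H.
have [kn|nk] := ltnP k n.+1; first exact: (H (Ordinal kn)).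
by rewrite !take_oversize ?intpart_sumn // (leq_trans (intpart_size _)) // ltnW.
Qed.

Lemma dominated_refl la : dominated la la.
Proof. exact/dominatedP. Qed.

Lemma dominated_trans ka mu la : dominated mu ka -> dominated ka la -> dominated mu la.
Proof.
move=> /dominatedP H1 /dominatedP H2; apply/dominatedP => k.
exact: leq_trans (H1 k) (H2 k).
Qed.

Lemma dominated_excess mu la : dominated mu la ->
  forall c, (\sum_(x <- mu) (x - c) <= \sum_(x <- la) (x - c))%N.
Proof.
move=> /dominatedP H c; have := sumn_take_excess_count c (intpart_sorted mu).
set k := count _ _; have := H k; have := sumn_take_le_excess c la k; lia.
Qed.

Lemma excess_dominated mu la :
  (forall c, \sum_(x <- mu) (x - c) <= \sum_(x <- la) (x - c))%N -> dominated mu la.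
Proof.
move=> H; apply/dominatedP => k.
have := sumn_take_excess_nth k (intpart_sorted la); set c := nth 0%N la k.
have := H c; have := sumn_take_le_excess c mu k; lia.
Qed.

Lemma sdominated_prefix_sum N mu la : (n <= N)%N -> sdominated mu la ->
  (prefix_sum N mu < prefix_sum N la)%N.
Proof.
move=> nN /andP[mula /dominatedP H]; rewrite ltn_neqAle leq_sum ?andbT //.
apply: contra mula => /eqP E.
have Ek k : (k < N.+1)%N -> sumn (take k mu) = sumn (take k la).
  move=> kN; apply/eqP; rewrite eqn_leq H /= leqNgt; apply/negP => lt.
  have : (prefix_sum N mu < prefix_sum N la)%N.
    rewrite /prefix_sum (bigD1 (Ordinal kN)) //= [X in (_ < X)%N](bigD1 (Ordinal kN)) //=.
    by rewrite -addSn leq_add // leq_sum.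
  by rewrite E ltnn.
have nthE k : nth 0%N mu k = nth 0%N la k.
  have [kN|Nk] := ltnP k N.
    have := Ek k.+1 kN; rewrite !sumn_take !big_ord_recr /= -!sumn_take Ek ?(ltnW kN) //; last exact: ltnW.
    by move/addnI.
  by rewrite !nth_default // (leq_trans (intpart_size _)) // (leq_trans nN).
have szE : size mu = size la.
  have sz (nu ka : intpart n) : (forall k, nth 0%N nu k = nth 0%N ka k) -> (size nu <= size ka)%N.
    move=> nk; rewrite leqNgt; apply/negP => lt.
    have := intpart_gt0 (mem_nth 0%N lt); rewrite nk nth_default //.
  by apply/eqP; rewrite eqn_leq !sz.
by apply/eqP/parts_inj/(@eq_from_nth _ 0%N) => // k _.
Qed.

Lemma sum_nth_big (N : nat) la (G : nat -> nat) : G 0%N = 0%N -> (n <= N)%N ->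
  (\sum_(r < N) G (nth 0 la r) = \sum_(x <- la) G x)%N.
Proof.
move=> G0 nN; have le := leq_trans (intpart_size la) nN.
rewrite (big_nth 0%N) big_mkord [RHS](big_ord_widen N (fun r => G (nth 0%N la r))) //.
rewrite [RHS]big_mkcond; apply: eq_bigr => r _; case: ltnP => // /(nth_default 0%N) ->.
exact: G0.
Qed.

(** For x <= n, x^2 + x is twice the sum of the excesses x - c over c < n, and dominance compares
    the total excess for each c. *)
Lemma dominated_sum_sqr mu la : dominated mu la ->
  (\sum_(x <- mu) x ^ 2 <= \sum_(x <- la) x ^ 2)%N.
Proof.
move=> /dominated_excess H.
have E (nu : intpart n) : ((\sum_(c < n) \sum_(x <- nu) (x - c)) * 2 = \sum_(x <- nu) x ^ 2 + n)%N.
  rewrite exchange_big big_distrl /= -[X in (_ + X)%N](intpart_sumn nu) sumnE -big_split /=.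
  by rewrite big_seq [RHS]big_seq; apply: eq_bigr => x /intpart_le; apply: sum_subn.
rewrite -(leq_add2r n) -!E leq_mul2r /=; apply: leq_sum => c _; exact: H.
Qed.

Variables (F : fieldType) (al : F).
Hypothesis charF0 : [pchar F] =i pred0.
Hypothesis alP : jack_param al.

(** The difference is al (a al + b), where a >= 0 is the difference of the sums of squares and b > 0
    twice that of the prefix sums. *)
Lemma sdominated_eigenvalue N mu la : (n <= N)%N -> sdominated mu la ->
  \sum_(r < N) (al * (nth 0%N la r)%:R - r%:R) ^+ 2 !=
  \sum_(r < N) (al * (nth 0%N mu r)%:R - r%:R) ^+ 2.
Proof.
move=> nN mula; have P := sdominated_prefix_sum nN mula.
have /andP[_ /dominated_sum_sqr S] := mula.
have E (nu : intpart n) : \sum_(r < N) (al * (nth 0%N nu r)%:R - r%:R) ^+ 2 =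
    al ^+ 2 * (\sum_(x <- nu) x ^ 2)%N%:R + 2%:R * al * (prefix_sum N nu)%:R
    - 2%:R * al * (N * n)%:R + (\sum_(r < N) r ^ 2)%N%:R.
  have B : (prefix_sum N nu + \sum_(r < N) r * nth 0 nu r = N * n)%N.
    rewrite /prefix_sum sum_sumn_take (sum_nth_big nu (G := id)) //.
    by rewrite -sumnE intpart_sumn.
  rewrite -B natrD mulrDr opprD addrA addrK -(@sum_nth_big N nu (fun x => x ^ 2)%N) //.
  rewrite !natr_sum !mulr_sumr -sumrN -!big_split /=; apply: eq_bigr => r _.
  by rewrite !natrX natrM; ring.
rewrite !E -subr_eq0.
set A := (\sum_(x <- la) x ^ 2)%N in S *; set A' := (\sum_(x <- mu) x ^ 2)%N in S *.
have -> : forall x y : F, al ^+ 2 * A%:R + 2%:R * al * (prefix_sum N la)%:R - x + y -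
   (al ^+ 2 * A'%:R + 2%:R * al * (prefix_sum N mu)%:R - x + y) =
   al * ((A - A')%N%:R * al + (2 * (prefix_sum N la - prefix_sum N mu))%N%:R).
  by move=> x y; rewrite natrM !natrB ?(ltnW P) //; ring.
have al0 : al != 0 by have := @param_neq0 _ al charF0 alP 1 0 isT; rewrite mul1r addr0.
by rewrite mulf_neq0 // param_neq0 //; lia.
Qed.

End DominanceOrder.

(** * Jack functions as eigenfunctions *)

Section JackFunctions.
Variables (F : fieldType) (al : F).
Hypothesis charF0 : [pchar F] =i pred0.
Hypothesis alP : jack_param al.
Variables (J : forall n : nat, intpart n -> symfun F).
Hypothesis JP : jack_functions al J.
Variable theta : forall n : nat, intpart n -> intpart n -> F.
Hypothesis thetaP : jack_characters J theta.

Variables (n M : nat).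
Local Notation N := M.+1.
Hypothesis nN : (n <= N)%N.
Implicit Types (mu la ka : intpart n) (g : {mpoly F[N]}) (m : 'X_{1..N}).

Definition padded la : seq nat := la ++ nseq (N - size la) 0%N.

Let size_le la : (size la <= N)%N := leq_trans (intpart_size la) nN.

Lemma size_padded la : size (padded la) = N.
Proof. by rewrite size_cat size_nseq subnKC. Qed.

Lemma nth_padded la i : nth 0%N (padded la) i = nth 0%N la i.
Proof.
rewrite nth_cat; case: ltnP => // li; rewrite nth_nseq nth_default //.
by case: ifP.
Qed.

Lemma sorted_padded la : sorted geq (padded la).
Proof.
apply/(sortedP 0%N) => i _; rewrite !nth_padded.
have [il|li] := ltnP i.+1 (size la); last by rewrite /= [X in (X <= _)%N]nth_default.
by have /(sortedP 0%N) := intpart_sorted la; apply.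
Qed.

Lemma sum_padded la (G : nat -> nat) : G 0%N = 0%N ->
  (\sum_(x <- padded la) G x = \sum_(x <- la) G x)%N.
Proof.
move=> G0; rewrite big_cat /= [X in (_ + X)%N]big1_seq ?addn0 // => x /andP[_].
by move/nseqP => [->].
Qed.

Lemma sumn_padded la : sumn (padded la) = n.
Proof. by rewrite sumnE (@sum_padded _ id) // -sumnE intpart_sumn. Qed.

Lemma filter_padded la : [seq x <- padded la | 0 < x]%N = la.
Proof.
rewrite filter_cat [X in _ ++ X](_ : _ = [::]) ?cats0; last first.
  by elim: (N - _)%N.
by apply/all_filterP/allP => x; apply: intpart_gt0.
Qed.

Lemma padded_perm_inj la mu : perm_eq (padded la) (padded mu) -> la = mu.
Proof.
move=> /(perm_filter (fun x => 0 < x)%N); rewrite !filter_padded.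
exact: intpart_perm_eq.
Qed.

Lemma perm_padded m la : perm_eq [seq x <- m | 0 < x]%N la = perm_eq m (padded la).
Proof.
apply/idP/idP => [E|/(perm_filter (fun x => 0 < x)%N)]; last by rewrite filter_padded.
have := permEl (perm_filterC (fun x => 0 < x)%N m); rewrite perm_sym => H.
apply: (perm_trans H); rewrite /padded.
have Z : [seq x <- m | predC (fun x => 0 < x)%N x] = nseq (N - size la) 0%N.
  have -> : (N - size la = size [seq x <- m | predC (fun x => 0 < x)%N x])%N.
    have := perm_size H; rewrite size_tuple size_cat (perm_size E) => sE.
    by rewrite [in LHS]sE addKn.
  by apply/all_pred1P/allP => x; rewrite mem_filter /= -leqNgt leqn0 => /andP[].
by rewrite Z perm_cat2r.
Qed.

Lemma mcoeff_msym m la : (Defs.msym F la N)@_m = (perm_eq m (padded la))%:R.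
Proof.
have mE : [seq m i | i <- enum 'I_N] = m :> seq nat.
  by rewrite -[RHS](map_tnth_enum m); apply: eq_map => i; rewrite mnm_tnth.
rewrite /Defs.msym raddf_sum /=.
case: (boolP (perm_eq _ _)) => [E|/negP E]; last first.
  rewrite big1 // => k; rewrite mcoeffX; case: eqP => // kE H; case: E.
  move: H; rewrite kE mE perm_padded => H; exact: H.
have mn : (mdeg m < (sumn la).+1)%N.
  by rewrite /mdeg ltnS (perm_big _ E) /= /padded big_cat /= -!sumnE sumn_nseq mul0n addn0.
rewrite (bigD1 (BMultinom mn)) /= ?mcoeffX ?eqxx ?mE ?perm_padded //.
rewrite big1 ?addr0 // => k /andP[_ kN]; rewrite mcoeffX.
by rewrite -val_eqE /= in kN; rewrite (negPf kN).
Qed.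

Definition padded_mnm la : 'X_{1..N} := mnm_of M (padded la).

Lemma val_padded_mnm la : padded_mnm la = padded la :> seq nat.
Proof. by rewrite val_mnm_of ?size_padded. Qed.

Lemma mcoeff_msym_padded_mnm mu la : (Defs.msym F la N)@_(padded_mnm mu) = (mu == la)%:R.
Proof.
rewrite mcoeff_msym val_padded_mnm; congr (nat_of_bool _)%:R.
by apply/idP/eqP => [/padded_perm_inj|->].
Qed.

Lemma exists_padded m : mdeg m = n -> exists la, perm_eq m (padded la).
Proof.
move=> mn; pose s := sort geq [seq x <- m | 0 < x]%N.
have sm : perm_eq s [seq x <- m | 0 < x]%N by rewrite perm_sort.
have ps : is_part n s.
  apply/and3P; split.
  - by apply: sort_sorted => x y; apply: leq_total.
  - by rewrite mem_sort mem_filter ltnn.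
  - rewrite (perm_sumn sm) -mn /mdeg sumnE big_filter big_mkcond.
    by apply/eqP/eq_bigr => x _; case: x.
have [la laE] := intpart_surj ps; exists la.
by rewrite -perm_padded laE perm_sym.
Qed.

Lemma symmetric_msym g : (forall s, msym s g = g) -> (forall m, g@_m != 0 -> mdeg m = n) ->
  g = \sum_(mu : intpart n) g@_(padded_mnm mu) *: Defs.msym F mu N.
Proof.
move=> gs gn; apply/mpolyP => m; rewrite raddf_sum /=.
have [mn|mn] := eqVneq (mdeg m) n; last first.
  rewrite big1 => [|mu _]; first by apply/eqP; apply: contraNT mn => /gn ->.
  rewrite mcoeffZ mcoeff_msym; case: (boolP (perm_eq _ _)) => E; last by rewrite mulr0.
  case/negP: mn; rewrite /mdeg (perm_big _ E) /= /padded big_cat /= -!sumnE sumn_nseq mul0n addn0.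
  by rewrite intpart_sumn.
have [la mla] := exists_padded mn.
rewrite (bigD1 la) //= big1 ?addr0 => [|mu muNla]; last first.
  rewrite mcoeffZ mcoeff_msym; case: (boolP (perm_eq _ _)) => E; last by rewrite mulr0.
  case/negP: muNla; apply/eqP; apply: padded_perm_inj.
  by apply: perm_trans mla; rewrite perm_sym.
rewrite mcoeffZ mcoeff_msym mla mulr1.
have /tuple_permP[s sE] : perm_eq m (padded_mnm la) by rewrite val_padded_mnm.
rewrite -[in RHS](gs s) mcoeff_sym; congr (_@__); apply/mnmP => i.
by rewrite (mnm_nth 0%N) sE nth_mktuple -mnm_tnth mnmE.
Qed.

Lemma boxprod_padded (A : comPzRingType) la (f : nat -> nat -> A) :
  boxprod (padded la) f = boxprod la f.
Proof.
rewrite !boxprodE size_padded -(prod_nat_trunc _ (size_le la)).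
apply: eq_bigr => i _; rewrite nth_padded; case: ltnP => // li.
by rewrite nth_default // big_geq.
Qed.

Lemma hook_padded la : hook al (padded la) = hook al la.
Proof.
rewrite /hook -boxprod_padded !boxprodE; apply: eq_big_nat => i /andP[_ iN].
apply: eq_big_nat => j /andP[_ ji]; rewrite /arm nth_padded; congr (_ + _%:R + _).
rewrite /leg /padded drop_cat; case: ltnP => il.
  by rewrite count_cat count_nseq ltn0 mul0n addn0.
by rewrite drop_nseq count_nseq ltn0 mul0n drop_oversize.
Qed.

Lemma hook_neq0 la : hook al la != 0.
Proof.
rewrite /hook !boxprodE prodf_seq_neq0; apply/allP => i _ /=.
rewrite prodf_seq_neq0; apply/allP => j _ /=.
have := @param_neq0 _ al charF0 alP (arm la i j) (leg la i j).+1 ltac:(lia).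
by rewrite -natr1 addrA mulrC.
Qed.

Let jdot := @jack_dot F al n.

Lemma jack_dot_suml (I : finType) (a : I -> F) (c : I -> intpart n -> F) e :
  jdot (fun mu => \sum_i a i * c i mu) e = \sum_i a i * jdot (c i) e.
Proof.
rewrite /jdot /jack_dot; under eq_bigr do rewrite !mulr_suml.
rewrite exchange_big /=; apply: eq_bigr => i _; rewrite mulr_sumr.
by apply: eq_bigr => mu _; ring.
Qed.

Lemma jack_dot_theta la mu : la != mu -> jdot (theta la) (theta mu) = 0.
Proof. by move=> lamu; apply: (jack_orth JP lamu); apply: thetaP. Qed.

Lemma jack_leading la : exists u : intpart n -> F, forall K, J la K =
  hook al la *: Defs.msym F la K +
  \sum_(mu | sdominated mu la) u mu *: Defs.msym F mu K.
Proof. exact: jack_triangular JP _ _. Qed.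

Lemma jack_psym la : J la N = \sum_mu theta la mu *: psym F mu N.
Proof. exact: thetaP. Qed.

Lemma mcoeff_jack la mu : (J la N)@_(padded_mnm mu) != 0 -> mu = la \/ sdominated mu la.
Proof.
have [u ->] := jack_leading la; rewrite mcoeffD mcoeffZ mcoeff_msym_padded_mnm raddf_sum /=.
have [->|muNla] := eqVneq mu la; first by left.
have [|muNdom] := boolP (sdominated mu la); first by right.
rewrite mulr0 add0r big1 ?eqxx // => ka kala; rewrite mcoeffZ mcoeff_msym_padded_mnm.
by case: eqP muNdom => [->|]; rewrite ?kala // mulr0.
Qed.

Lemma mcoeff_jack_lead la : (J la N)@_(padded_mnm la) = hook al la.
Proof.
have [u ->] := jack_leading la; rewrite mcoeffD mcoeffZ mcoeff_msym_padded_mnm eqxx mulr1 raddf_sum /=.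
rewrite big1 ?addr0 // => mu /andP[mula _]; rewrite mcoeffZ mcoeff_msym_padded_mnm.
by rewrite eq_sym (negPf mula) mulr0.
Qed.

(** Among the la with a la != 0, one of maximal [prefix_sum] lies strictly below no other, so its
    leading monomial comes from J la only. *)
Lemma jack_free (a : intpart n -> F) : \sum_la a la *: J la N = 0 -> forall la, a la = 0.
Proof.
move=> E la0; apply/eqP; apply: contraT => a0.
case: (arg_maxnP (P := fun la => a la != 0) (fun la => prefix_sum N la) a0) => la al_ lamax.
have := congr1 (mcoeff (padded_mnm la)) E; rewrite raddf_sum /= mcoeff0 (bigD1 la) //= big1 ?addr0.
  rewrite mcoeffZ mcoeff_jack_lead => /eqP; rewrite mulf_eq0 (negPf al_) (negPf (hook_neq0 _)).
  by [].
move=> mu mula; rewrite mcoeffZ; apply/eqP; apply: contraT.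
rewrite mulf_eq0 negb_or => /andP[amu /mcoeff_jack[E'|H]].
  by rewrite E' eqxx in mula.
by have := lamax _ amu; rewrite /= leqNgt (sdominated_prefix_sum nN H).
Qed.

(** The square matrix theta is invertible: a relation between its rows would be one between the J
    la, excluded by [jack_free]. *)
Lemma theta_span (c : intpart n -> F) : exists a : intpart n -> F,
  forall mu, c mu = \sum_la a la * theta la mu.
Proof.
pose A := \matrix_(i < #|{: intpart n}|, j < #|{: intpart n}|) theta (enum_val i) (enum_val j).
have sumE (G : intpart n -> F) : \sum_la G la = \sum_(i < #|{: intpart n}|) G (enum_val i).
  by rewrite (reindex _ (onW_bij _ (enum_val_bij _))).

have Afree : row_free A.
  rewrite -kermx_eq0; apply/eqP/row_matrixP => i; rewrite row0.
  set v := row i _; have vA : v *m A = 0 by rewrite /v -row_mul mulmx_ker row0.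
  have J0 : \sum_la v 0 (enum_rank la) *: J la N = 0.
    rewrite (eq_bigr (fun la => \sum_mu (v 0 (enum_rank la) * theta la mu) *: psym F mu N)).
      rewrite exchange_big big1 //= => mu _; rewrite -scaler_suml sumE.
      have := congr1 (fun B : 'rV_ _ => B 0 (enum_rank mu)) vA; rewrite !mxE => H.
      rewrite [X in X *: _](_ : _ = 0) ?scale0r // -[RHS]H.
      by apply: eq_bigr => k _; rewrite !mxE enum_valK enum_rankK.
    move=> la _; rewrite jack_psym scaler_sumr; apply: eq_bigr => mu _.
    by rewrite scalerA.
  by apply/rowP => k; have := jack_free J0 (enum_val k); rewrite enum_valK => ->; rewrite mxE.
have Au : A \in unitmx by rewrite -row_free_unit.
pose w := (\row_j c (enum_val j)) *m invmx A.
exists (fun la => w 0 (enum_rank la)) => mu.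
have := congr1 (fun B : 'rV_ _ => B 0 (enum_rank mu)) (mulmxKV Au (\row_j c (enum_val j))).
rewrite -/w !mxE enum_rankK => <-; rewrite sumE.
by apply: eq_bigr => k _; rewrite !mxE enum_valK enum_rankK.
Qed.

Lemma psym_free (c : intpart n -> F) :
  \sum_mu c mu *: psym F mu N = 0 -> forall mu, c mu = 0.
Proof.
have [a aE] := theta_span c => E mu; rewrite aE.
suff a0 : forall la, a la = 0 by rewrite big1 // => la _; rewrite a0 mul0r.
apply: jack_free; rewrite -[RHS]E.
rewrite (eq_bigr (fun la => \sum_mu (a la * theta la mu) *: psym F mu N)).
  by rewrite exchange_big /=; apply: eq_bigr => ka _; rewrite aE scaler_suml.
move=> la _; rewrite jack_psym scaler_sumr; apply: eq_bigr => ka _.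
by rewrite scalerA.
Qed.

(** Otherwise theta la would be orthogonal to all rows, hence to everything by [theta_span], and so
    be 0, the form being diagonal with nonzero entries; then J la would be 0, against
    [jack_free]. *)
Lemma jack_norm_neq0 la : jdot (theta la) (theta la) != 0.
Proof.
apply/eqP => norm0.
have orth c : jdot c (theta la) = 0.
  have [a aE] := theta_span c.
  transitivity (jdot (fun mu => \sum_ka a ka * theta ka mu) (theta la)).
    by rewrite /jdot /jack_dot; apply: eq_bigr => mu _; rewrite aE.
  rewrite jack_dot_suml big1 // => ka _.
  by have [->|kala] := eqVneq ka la; rewrite ?norm0 ?jack_dot_theta // mulr0.
have theta0 mu : theta la mu = 0.
  have := orth (fun ka => (ka == mu)%:R); rewrite /jdot /jack_dot (bigD1 mu) //= big1 ?addr0.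
    rewrite eqxx mul1r => /eqP; rewrite mulf_eq0 => /orP[/eqP //|].
    rewrite mulf_eq0 expf_eq0 => /orP[/andP[_ /eqP a0]|].
      by have := @param_neq0 _ al charF0 alP 1 0 isT; rewrite a0 mulr0 addr0 eqxx.
    suff z0 : (0 < zpart mu)%N by rewrite (negPf (natr_neq0 charF0 z0)).
    rewrite /zpart big_add1 prodn_gt0 // => i.
    by rewrite muln_gt0 expn_gt0 fact_gt0.
  by move=> ka /negPf ->; rewrite !mul0r.
have : \sum_ka (ka == la)%:R *: J ka N = 0.
  rewrite (bigD1 la) //= eqxx scale1r big1 ?addr0 => [|ka /negPf ->]; last by rewrite scale0r.
  by rewrite jack_psym big1 // => mu _; rewrite theta0 scale0r.
by move/jack_free/(_ la)/eqP; rewrite eqxx oner_eq0.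
Qed.

Lemma msym_jack la : exists b : intpart n -> F,
  (forall ka, b ka != 0 -> dominated ka la) /\
  Defs.msym F la N = \sum_ka b ka *: J ka N.
Proof.
have [d] := ubnP (prefix_sum N la); elim: d la => // d IH la Sd.
have [u /(_ N) uE] := jack_leading la.
have /fin_all_exists[b bP] (mu : intpart n) : exists b : intpart n -> F,
    sdominated mu la -> (forall ka, b ka != 0 -> dominated ka mu) /\
    Defs.msym F mu N = \sum_ka b ka *: J ka N.
  have [mula|] := boolP (sdominated mu la); last by exists (fun=> 0).
  have [|b bP] := IH mu; last by exists b.
  by have := sdominated_prefix_sum nN mula; lia.
exists (fun ka => (hook al la)^-1 * ((ka == la)%:R - \sum_(mu | sdominated mu la) u mu * b mu ka)).
split=> [ka|].
  apply: contraR => kaNla; rewrite mulf_eq0 invr_eq0 (negPf (hook_neq0 _)) /=.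
  have [E|_] := eqVneq ka la; first by rewrite E dominated_refl in kaNla.
  rewrite sub0r oppr_eq0 big1 // => mu mula; have [b0 _] := bP mu mula.
  have [->|/b0 kamu] := eqVneq (b mu ka) 0; first by rewrite mulr0.
  by case/negP: kaNla; apply: dominated_trans kamu _; case/andP: mula.
pose T ka := \sum_(mu | sdominated mu la) u mu * b mu ka.
have S : \sum_ka T ka *: J ka N = \sum_(mu | sdominated mu la) u mu *: Defs.msym F mu N.
  rewrite (eq_bigr (fun ka => \sum_(mu | sdominated mu la) (u mu * b mu ka) *: J ka N)).
    rewrite exchange_big /=; apply: eq_bigr => mu mula; have [_ ->] := bP mu mula.
    by rewrite scaler_sumr; apply: eq_bigr => ka _; rewrite scalerA.
  by move=> ka _; rewrite scaler_suml.
rewrite (eq_bigr (fun ka => (hook al la)^-1 *: ((ka == la)%:R *: J ka N - T ka *: J ka N))).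
  rewrite -scaler_sumr sumrB S (bigD1 la) //= eqxx scale1r big1 ?addr0; last first.
    by move=> ka /negPf ->; rewrite scale0r.
  by rewrite uE addrK scalerA mulVf ?hook_neq0 // scale1r.
by move=> ka _; rewrite -scalerBl scalerA.
Qed.

Lemma dominated_eqVs mu la : dominated mu la -> mu = la \/ sdominated mu la.
Proof.
by move=> D; have [->|N] := eqVneq mu la; [left | right; apply/andP].
Qed.

Lemma sdominated_trans ka mu la : dominated ka mu -> sdominated mu la -> sdominated ka la.
Proof.
move=> kamu mula; have P := sdominated_prefix_sum nN mula.
have /andP[_ D] := mula; apply/andP; split; last exact: dominated_trans D.
apply: contraTneq P => <-; rewrite -leqNgt; case: (dominated_eqVs kamu) => [->//|].
by move/(sdominated_prefix_sum nN)/ltnW.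
Qed.

Local Notation one := (fun _ : 'I_N => 1 : F).
Local Notation eigenvalue la := (\sum_(r < N) (al * (nth 0%N (la : intpart n) r)%:R - r%:R) ^+ 2).

(** With h g the rescaled symmetrization, J la - h g is a combination \sum B_ka J ka over ka
    strictly below la. By induction J ka is an eigenfunction for another eigenvalue, so it is
    orthogonal to h g, as it is to J la; pairing with it leaves B_ka <J ka, J ka> = 0. *)
Lemma jack_eigen_value la :
  cherednik2 al (J la N) = eigenvalue la *: J la N /\
  (J la N).@[one] = boxprod la (fun i j => N%:R + (al * j%:R - i%:R)).
Proof.
have [d] := ubnP (prefix_sum N la); elim: d la => // d IH la Sd.
have [g [gs gxi g1 gsupp gv]] :=
  sym_jack_exists charF0 alP (sorted_padded la) (size_padded la).
set h := hook al la.
have hgxi : cherednik2 al (h *: g) = eigenvalue la *: (h *: g).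
  rewrite cherednik2Z gxi !scalerA mulrC; congr (_ * _ *: _).
  by apply: eq_bigr => r _; rewrite nth_padded.
suff JE : J la N = h *: g.
  by rewrite JE mevalZ -boxprod_padded -gv hook_padded.
have [u /(_ N) uE] := jack_leading la.
have gE : g = Defs.msym F la N + \sum_(mu | sdominated mu la) g@_(padded_mnm mu) *: Defs.msym F mu N.
  have gn m : g@_m != 0 -> mdeg m = n.
    move/gsupp => [E|[-> _]]; last exact: sumn_padded.
    by rewrite /mdeg (perm_big _ E) /= -sumnE sumn_padded.
  rewrite [LHS](symmetric_msym gs gn) (bigD1 la) //= g1 ?val_padded_mnm // scale1r; congr (_ + _).
  rewrite [RHS]big_mkcond [LHS]big_mkcond; apply: eq_bigr => mu _.
  have [->|muNla] := eqVneq mu la; first by rewrite /sdominated eqxx.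
  case: ifP => // muNdom; have [->|] := eqVneq g@_(padded_mnm mu) 0; first by rewrite scale0r.
  move/gsupp; rewrite val_padded_mnm => -[/padded_perm_inj E|[_ H]]; first by rewrite E eqxx in muNla.
  case/negP: muNdom; rewrite /sdominated muNla /=; apply: excess_dominated => c.
  by move: (H c); rewrite excess_seq val_padded_mnm !(@sum_padded _ (fun x => x - c)%N).
have /fin_all_exists[b bP] := msym_jack.
pose B ka := \sum_(mu | sdominated mu la) (u mu - h * g@_(padded_mnm mu)) * b mu ka.
have vE : J la N - h *: g = \sum_ka B ka *: J ka N.
  transitivity (\sum_(mu | sdominated mu la) (u mu - h * g@_(padded_mnm mu)) *: Defs.msym F mu N).
    rewrite uE {1}gE scalerDr opprD addrACA subrr add0r scaler_sumr -sumrB.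
    by apply: eq_bigr => mu _; rewrite scalerA scalerBl.
  rewrite (eq_bigr (fun mu => \sum_ka ((u mu - h * g@_(padded_mnm mu)) * b mu ka) *: J ka N)).
    by rewrite exchange_big /=; apply: eq_bigr => ka _; rewrite scaler_suml.
  move=> mu _; have [_ ->] := bP mu.
  by rewrite scaler_sumr; apply: eq_bigr => ka _; rewrite scalerA.
have Bsupp ka : B ka != 0 -> sdominated ka la.
  apply: contraR => kaNla; rewrite /B big1 // => mu mula; have [b0 _] := bP mu.
  have [->|/b0 kamu] := eqVneq (b mu ka) 0; first by rewrite mulr0.
  by case/negP: kaNla; apply: sdominated_trans kamu mula.
(* The coefficients of h g on the power sums, where the scalar product is defined. *)
pose c mu := theta la mu - \sum_ka B ka * theta ka mu.
have cE : h *: g = \sum_mu c mu *: psym F mu N.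
  have -> : h *: g = J la N - \sum_ka B ka *: J ka N by rewrite -vE subKr.
  have -> : \sum_ka B ka *: J ka N = \sum_ka \sum_mu (B ka * theta ka mu) *: psym F mu N.
    apply: eq_bigr => ka _; rewrite jack_psym scaler_sumr.
    by apply: eq_bigr => mu _; rewrite scalerA.
  rewrite jack_psym /c exchange_big /= -sumrB; apply: eq_bigr => mu _.
  by rewrite scalerBl -scaler_suml.
have B0 ka : B ka = 0.
  apply/eqP; apply: contraT => /[dup] Bka /Bsupp kala.
  have [|kaxi _] := IH ka; first by have := sdominated_prefix_sum nN kala; lia.
  have := eigen_orth (al := al) charF0 (@psym_free) (c := c) (d := theta ka) (e := eigenvalue la) (e' := eigenvalue ka).
  rewrite -cE -jack_psym => /(_ hgxi kaxi (sdominated_eigenvalue charF0 alP nN kala)).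
  have ka_la : la != ka by rewrite eq_sym; case/andP: kala.
  have -> : jack_dot al c (theta ka) = jdot (theta la) (theta ka) -
      \sum_ka' B ka' * jdot (theta ka') (theta ka).
    rewrite -jack_dot_suml /jdot /jack_dot -sumrB; apply: eq_bigr => mu _.
    by rewrite /c; ring.
  rewrite jack_dot_theta // sub0r (bigD1 ka) //= big1 ?addr0; last first.
    by move=> ka' H; rewrite jack_dot_theta // mulr0.
  by move/eqP; rewrite oppr_eq0 mulf_eq0 (negPf (jack_norm_neq0 _)) orbF (negPf Bka).
by apply/eqP; rewrite -subr_eq0 vE big1 // => ka _; rewrite B0 scale0r.
Qed.

End JackFunctions.

(** * From large integers to an indeterminate *)

Section PrincipalSpecialization.
Variables (F : fieldType) (al : F).
Hypothesis charF0 : [pchar F] =i pred0.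
Hypothesis alP : jack_param al.
Variables (J : forall n : nat, intpart n -> symfun F).
Hypothesis JP : jack_functions al J.
Variable theta : forall n : nat, intpart n -> intpart n -> F.
Hypothesis thetaP : jack_characters J theta.
Variable n : nat.
Implicit Types (la mu : intpart n).

Lemma jack_value_nat la N : (n < N)%N ->
  \sum_mu theta la mu * N%:R ^+ size mu =
  boxprod la (fun i j => N%:R + (al * j%:R - i%:R)).
Proof.
case: N => // M nN; have nN' := ltnW nN.
have [_ <-] := jack_eigen_value charF0 alP JP thetaP nN' la.
rewrite (jack_psym thetaP) raddf_sum /=; apply: eq_bigr => mu _; rewrite mevalZ; congr (_ * _).
rewrite /psym rmorph_prod /= (eq_bigr (fun=> M.+1%:R)); last first.
  move=> k _; rewrite raddf_sum /= (eq_bigr (fun=> 1)) ?sumr_const ?card_ord // => i _.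
  by rewrite rmorphXn /= mevalXU expr1n.
by rewrite big_const_seq count_predT iter_mulr_1.
Qed.

Lemma horner_jackR la (x : F) :
  (jackR al la ('X : {poly F})).[x] = boxprod la (fun i j => x + (al * j%:R - i%:R)).
Proof.
rewrite /jackR /boxprod horner_prod; apply: eq_bigr => i _; rewrite horner_prod.
by apply: eq_bigr => j _; rewrite hornerD hornerX alg_polyC hornerC.
Qed.

(** The difference p of the two sides vanishes at n + 1 + k for k < size p, that is, at more
    distinct points than its degree if p != 0. The points start above n so that [jack_value_nat]
    applies. *)
Lemma jackR_theta_poly la :
  \sum_mu theta la mu *: 'X^(size mu) = jackR al la 'X :> {poly F}.
Proof.
apply/eqP; rewrite -subr_eq0; set p := _ - _.
pose rs := [seq (n.+1 + k)%:R : F | k <- iota 0 (size p)].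
apply/eqP/(@roots_geq_poly_eq0 _ _ rs); last by rewrite size_map size_iota.
  apply/allP => x /mapP[k _ ->]; rewrite /root /p hornerD hornerN horner_jackR.
  rewrite -jack_value_nat; last by lia.
  rewrite horner_sum -sumrB big1 // => mu _.
  by rewrite hornerZ hornerXn subrr.
rewrite map_inj_uniq ?iota_uniq // => i j /eqP.
wlog ij : i j / (i <= j)%N => [H|].
  by case/orP: (leq_total i j) => le; [|rewrite eq_sym]; move/H => ->.
rewrite eq_sym -subr_eq0 -natrB; last by lia.
by rewrite ((pcharf0P F).1 charF0) => /eqP; lia.
Qed.

Lemma jackR_theta (A : comAlgType F) la (x : A) :
  \sum_mu theta la mu *: x ^+ size mu = jackR al la x.
Proof.
have := congr1 (horner_alg x) (jackR_theta_poly la); rewrite raddf_sum /=.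
rewrite (eq_bigr (fun mu : intpart n => theta la mu *: x ^+ size mu)) => [->|mu _].
  rewrite /jackR /boxprod rmorph_prod; apply: eq_bigr => i _; rewrite rmorph_prod.
  apply: eq_bigr => j _ /=.
  by rewrite alg_polyC rmorphD /= horner_algX horner_algC.
by rewrite -mul_polyC rmorphM rmorphXn /= horner_algX horner_algC mulr_algl.
Qed.

End PrincipalSpecialization.

Theorem theorem7
    (F : fieldType) (charF0 : [pchar F] =i pred0)
    (alpha : F) (alphaP : jack_param alpha)
    (J : forall n : nat, intpart n -> symfun F) (JP : jack_functions alpha J)
    (theta : forall n : nat, intpart n -> intpart n -> F)
    (thetaP : jack_characters J theta)
    (n s : nat) (n_ge1 : (1 <= n)%N) (s_ge1 : (1 <= s)%N)
    (* a_{n,p} = 0 when some p_i > n: the infinite sum over p_1, ..., p_s >= 1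
       is the common value of the sums over 1 <= p_i <= B, for all B >= n. *)
    (B : nat) (n_leB : (n <= B)%N) :
  \sum_(p : {ffun 'I_s -> 'I_B.+1} | [forall i, (1 <= p i)%N])
     jack_coef alpha theta n (fun i => p i : nat) *: \prod_(i < s) 'X_i ^+ p i
  = \sum_(beta : intpart n)
      (hook alpha beta * hook' alpha beta)^-1 *:
        \prod_(i < s) jackR alpha beta ('X_i)
  :> {mpoly F[s]}.
Proof.
have sizeB (mu : intpart n) : (size mu < B.+1)%N by rewrite ltnS (leq_trans (intpart_size mu)).
have size_gt0 (mu : intpart n) : (0 < size mu)%N.
  by rewrite lt0n; apply: contraL n_ge1 => /nilP mu0; rewrite -(intpart_sumn mu) mu0.
pose C (beta : intpart n) := (hook alpha beta * hook' alpha beta)^-1.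
(* The tuple of lengths: n <= B makes it a valid index and 1 <= n makes its entries positive, so
   each la is counted for exactly one p. *)
pose sz (la : {ffun 'I_s -> intpart n}) := [ffun i => Ordinal (sizeB (la i))].
transitivity (\sum_(la : {ffun 'I_s -> intpart n}) \sum_(beta : intpart n)
    C beta *: \prod_(i < s) (theta n beta (la i) *: 'X_i ^+ size (la i)) : {mpoly F[s]}).
  rewrite (partition_big sz (fun p => [forall i, (1 <= p i)%N])) /=; last first.
    by move=> la _; apply/forallP => i; rewrite ffunE /= size_gt0.
  apply: eq_bigr => p _; rewrite /jack_coef scaler_suml; apply: eq_big => [la|la].
    apply/forallP/eqP => [H|<- i]; last by rewrite ffunE.
    by apply/ffunP => i; apply: val_inj; rewrite ffunE /=; apply/eqP; apply: H.
  move=> /forallP laE; rewrite scaler_suml; apply: eq_bigr => beta _.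
  rewrite scaler_prod scalerA; congr (_ *: _); apply: eq_bigr => i _.
  by rewrite (eqP (laE i)).
rewrite exchange_big /=; apply: eq_bigr => beta _; rewrite -scaler_sumr; congr (_ *: _).
(* The sum over all s-tuples of partitions factors into s sums over one partition, each a principal
   specialization. *)
rewrite -(bigA_distr_bigA (fun i mu => theta n beta mu *: 'X_i ^+ size mu)) /=.
by apply: eq_bigr => i _; rewrite (jackR_theta charF0 alphaP JP thetaP).
Qed.
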